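(* Let $1<p<\infty$. There is a constant $C>0$, depending only on $p$ and the doubling constant $D$, such that for every $w\in A_p$, with $\sigma=w^{1-p'}$, and every $f\in L^p_w(G)$, $$\|Mf\|_{L^p_w(G)}\le C\left([w]_{A_p}[\sigma]_{A_\infty}\right)^{1/p}\|f\|_{L^p_w(G)}.$$ In particular, $$\|M\|_{L^p_w(G)\to L^p_w(G)}\le C\,[w]_{A_p}^{\frac1{p-1}}.$$
   Context: $G$ is a locally compact abelian group (written additively) with a measure $\mu$ that is inner regular and satisfies $\mu(K)<\infty$ for every compact $K\subset G$ ($\mu$ is not assumed translation invariant). A covering family for $G$ is a collection $\{U_i\}_{i\in\mathbb{Z}}$ such that: (1) $\{U_i\}_{i\in\mathbb{Z}}$ is an increasing base of relatively compact neighborhoods of $0$, $\bigcup_{i\in\mathbb{Z}}U_i=G$ and $\bigcap_{i}U_i=\{0\}$; (2) there are a constant $D\ge 1$ (the doubling constant) and an increasing function $\theta:\mathbb{Z}\to\mathbb{Z}$ such that for all $i\in\mathbb{Z}$ and $x\in G$: $i\le\theta(i)$, $U_i-U_i\subset U_{\theta(i)}$, and $\mu(x+U_{\theta(i)})\le D\,\mu(x+U_i)$. A covering family for $G$ is fixed, with $D$ and $\theta$ as in (2), and the sets $U_i$ are assumed symmetric ($U_i=-U_i$). Base sets are the elements of $\mathcal{B}:=\{x+U_i: x\in G, i\in\mathbb{Z}\}$. The Hardy-Littlewood maximal function is $Mf(x)=\sup_{x\in U\in\mathcal{B}}\frac1{\mu(U)}\int_U|f|\,d\mu$. A weight is a nonnegative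 locally integrable function on $G$; $L^p_w(G)=L^p(G,w\,d\mu)$. For $1<p<\infty$, with $\frac1p+\frac1{p'}=1$, a weight $w$ is in $A_p$ if $$[w]_{A_p}:=\sup_{U\in\mathcal{B}}\left(\frac1{\mu(U)}\int_U w\,d\mu\right)\left(\frac1{\mu(U)}\int_U w^{1-p'}\,d\mu\right)^{p-1}<\infty.$$ The $A_\infty$ constant of a weight $w$ is $$[w]_{A_\infty}:=\sup_{U\in\mathcal{B}}\frac1{w(U)}\int_U M(w\chi_U)\,d\mu,\qquad w(U)=\int_U w\,d\mu.$$ *)

(* Defs.v *)
From HB Require Import structures.
From mathcomp Require Import all_boot all_order all_algebra.
From mathcomp Require Import all_classical all_reals all_analysis measurable_realfun.

Set Implicit Arguments.
Unset Strict Implicit.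
Unset Printing Implicit Defensive.
Import Order.TTheory GRing.Theory Num.Theory.
Import numFieldNormedType.Exports.

Local Open Scope classical_set_scope.
Local Open Scope ring_scope.

(* A topological abelian group seen as a measurable space, with its Borel
   sigma-algebra.  The library's [g_sigma_algebraType] needs a pointed type,
   which a [topologicalZmodType] is not; the point chosen here is 0. *)
Definition borelType (G : topologicalZmodType) : Type := G.

Section borel.
Variable G : topologicalZmodType.
HB.instance Definition _ := Choice.on (borelType G).
HB.instance Definition _ := isPointed.Build (borelType G) (0 : G).
HB.instance Definition _ := @isMeasurable.Build (sigma_display (@open G))
  (borelType G) <<s @open G >>
  (@sigma_algebra0 _ setT (@open G))
  (@sigma_algebraC (borelType G) (@open G))
  (@sigma_algebra_bigcup _ setT (@open G)).
End borel.

Definition translate (G : zmodType) (x : G) (V : set G) : set G :=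
  [set x + y | y in V].

Definition inner_regular (R : realType) (G : topologicalZmodType)
    (mu : {measure set (borelType G) -> \bar R}) : Prop :=
  forall A : set (borelType G), measurable A ->
    mu A = ereal_sup [set mu K | K in [set K : set G | compact K /\ K `<=` A]].

Record LCA_measure (R : realType) (G : topologicalZmodType)
    (mu : {measure set (borelType G) -> \bar R}) : Prop := {
  LCA_hausdorff : hausdorff_space G ;
  LCA_locally_compact : locally_compact [set: G] ;
  LCA_inner_regular : inner_regular mu ;
  LCA_compact_finite : forall K : set G, compact K -> (mu K < +oo)%E }.

(* Neighborhoods need not be open.  [cf_measurable] is what makes
   mu (x + U i) meaningful. *)
Record covering_family (R : realType) (G : topologicalZmodType)
    (mu : {measure set (borelType G) -> \bar R}) (D : R) (theta : int -> int)
    (U : int -> set G) : Prop := {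
  cf_increasing : forall i j : int, i <= j -> U i `<=` U j ;
  cf_nbhs : forall i, nbhs (0 : G) (U i) ;
  cf_base : forall A : set G, nbhs (0 : G) A -> exists i, U i `<=` A ;
  cf_precompact : forall i, precompact (U i) ;
  cf_measurable : forall i, measurable (U i : set (borelType G)) ;
  cf_bigcup : \bigcup_i U i = setT ;
  cf_bigcap : \bigcap_i U i = [set 0] ;
  cf_doubling_ge1 : 1 <= D ;
  cf_theta_increasing : forall i j : int, i <= j -> theta i <= theta j ;
  cf_theta_ge : forall i, i <= theta i ;
  cf_sub : forall i, [set x - y | x in U i & y in U i] `<=` U (theta i) ;
  cf_doubling : forall i (x : G),
    (mu (translate x (U (theta i))) <= D%:E * mu (translate x (U i)))%E }.

Definition base_sets (G : zmodType) (U : int -> set G) : set (set G) :=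
  [set V | exists x i, V = translate x (U i)].

(* [poweR 0 r] is 0 even when r < 0; here 0 to a negative power is +oo. *)
Definition poweRz (R : realType) (x : \bar R) (r : R) : \bar R :=
  (if (r < 0)%R then (poweR x (- r))^-1 else poweR x r)%E.

Section weights.
Variables (R : realType) (G : topologicalZmodType).
Variables (mu : {measure set (borelType G) -> \bar R}) (U : int -> set G).
Local Open Scope ereal_scope.
Implicit Types (V : set (borelType G)) (f w : borelType G -> \bar R).

(* When mu V = 0 this is +oo * 0 = 0. *)
Definition average V f : \bar R := (mu V)^-1 * \int[mu]_(x in V) f x.

(* [maximal f] need not be measurable, as it is a supremum over uncountably many
   sets; the library's integral of a nonnegative function is then the supremum
   of the integrals of the simple functions below it. *)
Definition maximal f : borelType G -> \bar R := fun x =>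
  ereal_sup [set average V (fun y => `|f y|)
            | V in [set V | base_sets U V /\ V x]].

Record weight := Weight {
  weight_fun :> borelType G -> \bar R ;
  weight_measurable : measurable_fun setT weight_fun ;
  weight_ge0 : forall x, 0 <= weight_fun x ;
  weight_locally_integrable :
    forall K : set G, compact K -> \int[mu]_(x in K) weight_fun x < +oo }.

Definition weighted_measure (w : weight) : set (borelType G) -> \bar R :=
  fun A => \int[mu]_(x in A) w x.

Section weighted_measure.
Variable w : weight.

Let wm0 : weighted_measure w set0 = 0.
Proof. exact: integral_set0. Qed.

Let wm_ge0 A : 0 <= weighted_measure w A.
Proof. by apply: integral_ge0 => x _; exact: weight_ge0. Qed.

Let wm_sigma_additive : semi_sigma_additive (weighted_measure w).
Proof.
exact: (semi_sigma_additive_nng_induced (weight_measurable w) (weight_ge0 w)).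
Qed.

HB.instance Definition _ := isMeasure.Build _ _ _ (weighted_measure w)
  wm0 wm_ge0 wm_sigma_additive.

End weighted_measure.

(* w ^ (1 - p'), with 1/p + 1/p' = 1 *)
Definition dual_weight (p : R) w : borelType G -> \bar R :=
  fun x => poweRz (w x) (1 - fine (hoelder_conjugate p%:E))%R.

Definition Ap_const (p : R) w : \bar R :=
  ereal_sup [set average V w * poweR (average V (dual_weight p w)) (p - 1)%R
            | V in base_sets U].

Definition Ap (p : R) (w : weight) : Prop := Ap_const p w < +oo.

Definition Ainfty_const w : \bar R :=
  ereal_sup [set (\int[mu]_(x in V) w x)^-1
                 * \int[mu]_(x in V) maximal (w \_ V) x
            | V in base_sets U].

(* Operator norm of the maximal operator on L^p(G, w dmu). *)
Definition maximal_norm (p : R) (w : weight) : \bar R :=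
  ereal_sup [set 'N[weighted_measure w]_p%:E[maximal (EFin \o f)]
            | f in [set f : borelType G -> R |
                     f \in Lfun (weighted_measure w) p%:E /\
                     'N[weighted_measure w]_p%:E[EFin \o f] <= 1]].

End weights.

(* Main.v *)
Require Import Defs.
From HB Require Import structures.
From mathcomp Require Import all_boot all_order all_algebra.
From mathcomp Require Import all_classical all_reals all_analysis measurable_realfun.
From mathcomp Require Import ring lra zify.

(* No dyadic cubes, Lebesgue differentiation or reverse Hoelder inequality are
   needed.  Write sigma = w ^ (1 - p'), f = g sigma, and let B* be the dilate
   s + U (theta (theta i)) of a ball B = s + U i.  As G is separable, countably
   many balls suffice, up to the factor D ^ 2.

   (1) Averages int_B g dlambda / lambda(B* ) are harmless for every measure
   lambda: by Vitali's covering argument their supremum is of weak type (1,1)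
   with constant 1, hence bounded on L^p(lambda) with a constant depending on p
   only, even when lambda is not doubling.

   (2) Lerner's pointwise inequality
   (Mf) ^ (p-1) <= C [w] N_w (N_sigma(g) ^ (p-1) / w), with N_lambda as in (1),
   gives the bound C [w] ^ (1/(p-1)).

   (3) For the mixed bound, run through the levels a^k < average <= a^(k+1) and
   keep only balls containing a point which sees no average above a^(k+1).
   Vitali selects, on each level, disjoint balls which are sparse: at least half
   of B lies outside the union of the balls of level at least k + 2.  The A_p
   condition reduces the bound to a Carleson embedding
   sum (int_B g dsigma / sigma(B* )) ^ p sigma(B* ) <= C [sigma] int g ^ p dsigma,
   whose packing condition follows from sparseness and the definition of
   [sigma].  Balls of comparable size cannot be absorbed by a dilate in a
   sigma-doubling way, but sparseness bounds their overlap. *)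

Set Implicit Arguments.
Unset Strict Implicit.
Unset Printing Implicit Defensive.
Import Order.TTheory GRing.Theory Num.Theory.
Import numFieldNormedType.Exports.

Local Open Scope classical_set_scope.
Local Open Scope ring_scope.

(** * Measures with a density *)

Section density.
Local Open Scope ereal_scope.
Context d (T : measurableType d) (R : realType) (mu nu : {measure set T -> \bar R}).
Variable v : T -> R.
Hypothesis mv : measurable_fun setT v.
Hypothesis v0 : forall x, (0 <= v x)%R.
Hypothesis nuE : forall A, measurable A -> nu A = \int[mu]_(x in A) (v x)%:E.

Import HBNNSimple.

Let mvE D : measurable_fun D (EFin \o v).
Proof. exact/measurable_funTS/measurable_EFinP. Qed.

Let integral_density_nnsfun (h : {nnsfun T >-> R}) D : measurable D ->
  \int[nu]_(x in D) (h x)%:E = \int[mu]_(x in D) ((h x)%:E * (v x)%:E).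
Proof.
move=> mD.
have mi r : measurable_fun D (fun x => (r * \1_(h @^-1` [set r]) x)%:E).
  by apply: (measurable_comp measurableT) => //; exact: measurable_funM.
have i0 r x : (0 <= r * \1_(h @^-1` [set r]) x)%R.
  by rewrite -lee_fin; exact: nnfun_muleindic_ge0.
transitivity (\int[nu]_(x in D)
   (\sum_(y \in range h) (y * \1_(h @^-1` [set y]) x)%:E)).
  by apply: eq_integral => t _; rewrite fimfunE -fsumEFin.
rewrite ge0_integral_fsum//; last by move=> r x _; rewrite lee_fin.
transitivity (\int[mu]_(x in D) (\sum_(y \in range h)
    (y * \1_(h @^-1` [set y]) x)%:E * (v x)%:E)); last first.
  apply: eq_integral => x _; rewrite -ge0_mule_fsuml//.
    by rewrite fsumEFin// -(fimfunE _ x).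
  by move=> r; rewrite lee_fin.
rewrite ge0_integral_fsum//; last 2 first.
- by move=> r; apply: emeasurable_funM.
- by move=> r x _; rewrite mule_ge0// lee_fin.
apply: eq_fsbigr => r; rewrite inE => -[t _ <-].
rewrite integralZl_indic_nnsfun// integral_indic//.
under eq_integral do rewrite EFinM -muleA.
rewrite ge0_integralZl//; last 3 first.
- by apply: emeasurable_funM => //; exact/measurable_EFinP.
- by move=> x _; rewrite mule_ge0// lee_fin.
- by rewrite lee_fin.
congr (_ * _); rewrite nuE; last exact: measurableI.
rewrite setIC integral_mkcondr; apply: eq_integral => x _.
by rewrite epatch_indic muleC.
Qed.

(** Monotone convergence along simple approximations reduces this to indicators, where it is
    [nuE]. *)
Lemma integral_density (f : T -> \bar R) D : measurable D ->
  (forall x, D x -> 0 <= f x) -> measurable_fun D f ->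
  \int[nu]_(x in D) f x = \int[mu]_(x in D) (f x * (v x)%:E).
Proof.
move=> mD f0 mf; pose h := nnsfun_approx mD mf.
have cvgh x : D x -> (EFin \o h ^~ x) n @[n --> \oo] --> f x.
  by move=> Dx; exact: cvg_nnsfun_approx.
transitivity (limn (fun n => \int[nu]_(x in D) (h n x)%:E)).
  rewrite -monotone_convergence //.
  - by apply: eq_integral => x /[!inE] Dx; apply/esym/cvg_lim => //; exact: cvgh.
  - by move=> n; apply/measurable_funTS/measurable_EFinP.
  - by move=> n x Dx; rewrite lee_fin.
  - by move=> x Dx a b ab; rewrite lee_fin; exact/lefP/nd_nnsfun_approx.
under eq_fun do rewrite integral_density_nnsfun//.
rewrite -monotone_convergence //.
- apply: eq_integral => x /[!inE] Dx; apply/cvg_lim => //.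
  by apply: cvgeZr => //; exact: cvgh.
- move=> n; apply: emeasurable_funM => //.
  exact/measurable_funTS/measurable_EFinP.
- by move=> n x Dx; rewrite mule_ge0// lee_fin.
- move=> x Dx a b ab; rewrite lee_wpmul2r// ?lee_fin//.
  exact/lefP/nd_nnsfun_approx.
Qed.

End density.

(** * Vitali selection *)

Section selection.
Context (I : eqType) (rk : I -> int).

Lemma max_rank (s : seq I) : s != [::] ->
  exists2 m, m \in s & forall b, b \in s -> rk b <= rk m.
Proof.
elim: s => // a s IH _; have [->|/IH[m ms mP]] := eqVneq s [::].
  by exists a; rewrite ?mem_head// => b; rewrite inE => /eqP ->.
have [am|ma] := leP (rk a) (rk m).
  exists m; first by rewrite inE ms orbT.
  by move=> b; rewrite inE => /predU1P[->//|]; exact: mP.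
exists a; first exact: mem_head.
move=> b; rewrite inE => /predU1P[->//|/mP/le_trans]; apply; exact: ltW.
Qed.

(** Greedy choice: keep an element of maximal rank, discard everything in conflict with it, and
    recurse. What is discarded has at most the rank of the element that removed it. *)
Lemma greedy_selection (C : rel I) (s : seq I) :
  (forall b, b \in s -> C b b) -> symmetric C ->
  exists F : seq I, [/\ uniq F, {subset F <= s},
    forall b b', b \in F -> b' \in F -> b != b' -> ~~ C b b' &
    forall b, b \in s -> exists2 b', b' \in F & C b b' && (rk b <= rk b')].
Proof.
have [n] := ubnP (size s); elim: n s => // n IH s sn Cs Csym.
have [->|/max_rank[m ms mP]] := eqVneq s [::]; first by exists [::].
pose s' := [seq b <- s | ~~ C b m].
have [|b|//|F [uF Fs' dF cF]] := IH s'.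
(* [m] conflicts with itself, so the filtered list is strictly shorter. *)
- rewrite -ltnS; apply: leq_trans sn; rewrite ltnS size_filter.
  have := count_predC (C ^~ m) s.
  have : (0 < count (C ^~ m) s)%N by rewrite -has_count; apply/hasP; exists m; rewrite ?Cs.
  by move=> h <-; rewrite -[X in (X <= _)%N]add1n leq_add2r.
- by rewrite mem_filter => /andP[_]; exact: Cs.
have FC b : b \in F -> ~~ C b m by move=> /Fs'; rewrite mem_filter => /andP[].
exists (m :: F); split.
- by rewrite /= uF andbT; apply/negP => /FC; rewrite Cs.
- move=> b; rewrite inE => /predU1P[->//|/Fs'].
  by rewrite mem_filter => /andP[].
- move=> b b'; rewrite !inE => /predU1P[->|bF] /predU1P[->|b'F].
  + by rewrite eqxx.
  + by rewrite Csym FC.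
  + by rewrite FC.
  + exact: dF.
- move=> b bs; have [bm|bm] := boolP (C b m).
    by exists m; rewrite ?mem_head// bm mP.
  have [|b' b'F Cbb'] := cF b; first by rewrite mem_filter bm.
  by exists b'; rewrite // inE b'F orbT.
Qed.

End selection.

(** * Finite families of sets and their overlap *)

Section finite_sums.
Context d (T : measurableType d) (R : realType) (I : choiceType).
Implicit Types (mu : {measure set T -> \bar R}) (F : seq I) (E : I -> set T).

Lemma sum_indic_disjoint F E (x : T) : uniq F ->
  (forall b b', b \in F -> b' \in F -> b != b' -> E b `&` E b' = set0) ->
  \sum_(b <- F) \1_(E b) x <= 1 :> R.
Proof.
elim: F => [|a F IH]; first by rewrite big_nil.
rewrite cons_uniq => /andP[aF uF] dF; rewrite big_cons.
have [xa|xa] := pselect (E a x); last first.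
  rewrite indicE memNset// add0r; apply: IH => // b b' bF b'F.
  by apply: dF; rewrite inE (bF, b'F) orbT.
rewrite indicE mem_set// big_seq big1 ?addr0// => b bF.
rewrite indicE memNset// => xb.
have : (E a `&` E b) x by [].
rewrite dF ?mem_head ?inE ?bF ?orbT//.
by apply: contraNneq aF => ->.
Qed.

Lemma measure_cover_le mu F E : (forall b, measurable (E b)) ->
  (mu (\bigcup_(b in [set` F]) E b) <= \sum_(b <- F) mu (E b))%E.
Proof.
move=> mE; rewrite bigcup_seq; elim: F => [|a F IH].
  by rewrite !big_nil measure0.
rewrite !big_cons; apply: le_trans (measureU2 _ _ _) _ => //.
  exact: bigsetU_measurable.
by rewrite leeD2l.
Qed.

Lemma sum_integral_overlap mu F E (H : set T) (h : T -> \bar R) (N : R) :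
  (forall b, measurable (E b)) -> measurable H ->
  measurable_fun H h -> (forall x, H x -> 0 <= h x)%E ->
  (forall b, b \in F -> E b `<=` H) ->
  (forall x, H x -> \sum_(b <- F) \1_(E b) x <= N) ->
  (\sum_(b <- F) \int[mu]_(x in E b) h x <= N%:E * \int[mu]_(x in H) h x)%E.
Proof.
move=> mE mH mh h0 EH EN.
(* A negative overlap bound forces [H] to be empty. *)
have [N0|N0] := ltP N 0.
  have H0 : H = set0.
    rewrite -subset0 => x /EN /le_lt_trans/(_ N0).
    by rewrite ltNge sumr_ge0.
  rewrite H0 integral_set0 mule0 big_seq big1// => b /EH.
  by rewrite H0 subset0 => ->; rewrite integral_set0.
have m1 b : measurable_fun H (fun x => (\1_(E b) x)%:E : \bar R).
  exact/measurable_funTS/measurable_EFinP.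
have h1 b x : H x -> (0 <= h x * (\1_(E b) x)%:E)%E.
  by move=> Hx; rewrite mule_ge0 ?h0 ?lee_fin.
rewrite big_seq (eq_bigr (fun b => \int[mu]_(x in H) (h x * (\1_(E b) x)%:E))%E);
    last first.
  move=> b bF; rewrite -[in LHS](setIidl (EH _ bF)) setIC integral_mkcondr.
  by apply: eq_integral => x _; rewrite epatch_indic.
rewrite -big_seq -ge0_integral_sum//; last first.
  by move=> b; exact: emeasurable_funM.
rewrite -ge0_integralZl ?lee_fin//.
apply: ge0_le_integral => //.
- by move=> x Hx; apply: sume_ge0 => b _; exact: h1.
- by apply: emeasurable_sum => b; exact: emeasurable_funM.
- exact: measurable_funeM.
- move=> x Hx; rewrite -ge0_sume_distrr; last by move=> b _; rewrite lee_fin.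
  by rewrite muleC lee_wpmul2r ?h0// sumEFin lee_fin EN.
Qed.

Lemma integral_le_sum_indic mu F E (f : T -> R) (c : I -> R) :
  (forall b, measurable (E b)) -> measurable_fun setT f ->
  (forall x, 0 <= f x) -> (forall b, 0 <= c b) ->
  (forall x, f x <= \sum_(b <- F) c b * \1_(E b) x) ->
  (\int[mu]_x (f x)%:E <= \sum_(b <- F) (c b)%:E * mu (E b))%E.
Proof.
move=> mE mf f0 c0 fle.
have m1 b : measurable_fun setT (fun x => (\1_(E b) x)%:E : \bar R).
  exact/measurable_EFinP.
apply: (@le_trans _ _ (\int[mu]_x \sum_(b <- F) ((c b)%:E * (\1_(E b) x)%:E))%E).
  apply: ge0_le_integral => //.
  - by move=> x _; rewrite lee_fin.
  - exact/measurable_EFinP.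
  - by apply: emeasurable_sum => b; exact: measurable_funeM.
  - by move=> x _; under eq_bigr do rewrite -EFinM; rewrite sumEFin lee_fin.
rewrite ge0_integral_sum//; last 2 first.
- by move=> b; exact: measurable_funeM.
- by move=> b x _; rewrite -EFinM lee_fin mulr_ge0.
apply: lee_sum => b _; rewrite ge0_integralZl ?lee_fin//.
by rewrite integral_indic// setIT.
Qed.

Lemma ler_sum_subset (s t : seq I) (f : I -> R) : uniq s -> uniq t ->
  {subset s <= t} -> (forall b, 0 <= f b) ->
  \sum_(b <- s) f b <= \sum_(b <- t) f b.
Proof.
move=> us ut st f0; have st' : perm_eq s [seq b <- t | b \in s].
  apply: uniq_perm; rewrite ?filter_uniq// => b.
  by rewrite mem_filter; case: (boolP (b \in s)) => // /st ->.
rewrite (perm_big _ st')/= big_filter [leRHS](bigID (mem s))/=.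
by rewrite lerDl sumr_ge0.
Qed.

Lemma sum_measure_disjoint mu F E (H : set T) : uniq F ->
  (forall b, measurable (E b)) -> measurable H ->
  (forall b b', b \in F -> b' \in F -> b != b' -> E b `&` E b' = set0) ->
  (forall b, b \in F -> E b `<=` H) ->
  (\sum_(b <- F) mu (E b) <= mu H)%E.
Proof.
move=> uF mE mH dF EH.
have := @sum_integral_overlap mu F E H (cst 1%E) 1 mE mH (measurable_cst _)
   (fun _ _ => lee01) EH (fun x _ => sum_indic_disjoint x uF dF).
rewrite mul1e integral_cst// mul1e; apply: le_trans.
by under [leRHS]eq_bigr do rewrite integral_cst// mul1e.
Qed.

End finite_sums.

(* [eng_comparable] is the substitute for a geometric scale: of two intersecting
   balls, either one is so much smaller that the dilates are nested, or their
   measures are comparable. *)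
Record engulfing d (T : measurableType d) (R : realType)
    (mu : {measure set T -> \bar R}) (kappa : R) (B : nat -> set T)
    (rk : nat -> int) (dil : nat -> nat) : Prop := Engulfing {
  eng_kappa : 1 <= kappa ;
  eng_measurable : forall b, measurable (B b) ;
  eng_fin : forall b, (mu (B b) < +oo)%E ;
  eng_sub : forall b, B b `<=` B (dil b) ;
  eng_doubling : forall b, (mu (B (dil b)) <= kappa%:E * mu (B b))%E ;
  eng_vitali : forall b b', B b `&` B b' !=set0 -> rk b <= rk b' ->
    B b `<=` B (dil b') ;
  eng_comparable : exists big : nat -> nat, forall b b',
    B b `&` B b' !=set0 -> rk b <= rk b' ->
    (rk b < rk b' /\ B (dil b) `<=` B (dil b')) \/
    (B b' `<=` B (big b) /\ (mu (B (big b)) <= kappa%:E * mu (B b'))%E) }.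

(** * Finite maximal functions *)

Section fmax.
Context d (T : measurableType d) (R : realType) (B : nat -> set T).
Hypothesis mB : forall b, measurable (B b).
Implicit Types (s : seq nat) (beta : nat -> R).

(** Finiteness of [s] makes this measurable and, where it is positive, attained by a ball; the value
    is 0 at points outside all balls. *)
Definition fmax s beta (x : T) : R :=
  \big[Num.max/0]_(b <- s) (beta b * \1_(B b) x).

Lemma measurable_fmax s beta : measurable_fun setT (fmax s beta).
Proof.
rewrite /fmax; elim: s => [|b s IH].
  by under eq_fun do rewrite big_nil; exact: measurable_cst.
under eq_fun do rewrite big_cons.
by apply: measurable_maxr => //; apply: measurable_funM.
Qed.

Lemma fmax_ge0 s beta x : 0 <= fmax s beta x.
Proof. by rewrite /fmax; elim: s => [|b s IH]; rewrite ?big_nil// big_cons le_max IH orbT. Qed.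

Lemma fmax_ge s beta b x : b \in s -> B b x -> beta b <= fmax s beta x.
Proof.
rewrite /fmax => + Bx; elim: s => // a s IH.
rewrite inE big_cons le_max => /predU1P[<-|/IH ->]; last by rewrite orbT.
by rewrite indicE mem_set// mulr1 lexx.
Qed.

Lemma fmax_le s beta x y : 0 <= y ->
  (forall b, b \in s -> B b x -> beta b <= y) -> fmax s beta x <= y.
Proof.
move=> y0 H; rewrite /fmax big_seq; apply: bigmax_le => // b bs.
rewrite indicE; have [/[!inE] Bx|Bx] := boolP (x \in B b).
  by rewrite mulr1 H.
by rewrite mulr0.
Qed.

Lemma fmax_attained s beta x : 0 < fmax s beta x ->
  exists b, [/\ b \in s, B b x & fmax s beta x = beta b].
Proof.
rewrite /fmax; elim: s => [|a s IH]; first by rewrite big_nil ltxx.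
rewrite big_cons; case: (leP (beta a * \1_(B a) x)).
  by move=> _ /IH [b [bs Bx e]]; exists b; rewrite inE bs orbT.
rewrite indicE; have [/[!inE] Bx|Bx] := boolP (x \in B a).
  by rewrite mulr1 => _ _; exists a; rewrite mem_head.
by rewrite mulr0 ltxx.
Qed.

End fmax.

Section vitali.
Local Open Scope ereal_scope.
Context d (T : measurableType d) (R : realType) (B : nat -> set T).
Variables (rk : nat -> int) (dil : nat -> nat).
Hypothesis mB : forall b, measurable (B b).
Hypothesis vitali : forall b b', B b `&` B b' !=set0 -> (rk b <= rk b')%R ->
  B b `<=` B (dil b').
Variables (la Phi : {measure set T -> \bar R}) (k : R) (P : set nat) (H : set T).
Hypothesis mH : measurable H.
Hypothesis laPhi : forall b, P b -> la (B (dil b)) <= k%:E * Phi (B b).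
Hypothesis PH : forall b, P b -> B b `<=` H.

(** Each ball lies in the dilate of a selected ball of at least its rank, and the selected balls are
    disjoint inside [H]. Two measures occur because dilates are measured by [la] and balls by [Phi],
    linked only through [laPhi]. *)
Lemma vitali_measure_finite (s : seq nat) : (forall b, b \in s -> P b) ->
  (0 <= k)%R -> la (\bigcup_(b in [set` s]) B b) <= k%:E * Phi H.
Proof.
move=> sP k0; pose C b b' := `[< B b `&` B b' !=set0 >].
(* Intersecting is reflexive on nonempty balls only; empty ones add nothing to the union. *)
pose s' := [seq b <- s | `[< B b !=set0 >]].
have [b|b b'|F [uF Fs dF cF]] := @greedy_selection _ rk C s'.
- by rewrite mem_filter => /andP[/asboolP[x Bx] _]; apply/asboolP; exists x.
- by rewrite /C setIC.
have FP b : b \in F -> P b.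
  by move=> /Fs; rewrite mem_filter => /andP[_]; exact: sP.
apply: (@le_trans _ _ (la (\bigcup_(b in [set` F]) B (dil b)))).
  apply: le_measure; rewrite ?inE.
  - exact: fin_bigcup_measurable.
  - exact: fin_bigcup_measurable.
  move=> x [b /= bs Bx]; have [|b' b'F /andP[/asboolP Cb rb]] := cF b.
    by rewrite mem_filter bs andbT; apply/asboolP; exists x.
  by exists b' => //; exact: vitali Bx.
apply: le_trans (measure_cover_le _ _ _) _ => //.
apply: (@le_trans _ _ (\sum_(b <- F) k%:E * Phi (B b))).
  by rewrite big_seq [leRHS]big_seq; apply: lee_sum => b /FP; exact: laPhi.
rewrite -ge0_sume_distrr// lee_wpmul2l ?lee_fin//.
apply: sum_measure_disjoint => //; last by move=> b /FP; exact: PH.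
move=> b b' bF b'F /(dF _ _ bF b'F); rewrite /C => /asboolPn.
by move/set0P/negP; rewrite negbK => /eqP.
Qed.

(** Continuity from below along the balls of index less than [n]. *)
Lemma vitali_measure : (0 <= k)%R -> la (\bigcup_(b in P) B b) <= k%:E * Phi H.
Proof.
move=> k0; pose s n := [seq b <- iota 0 n | `[< P b >]].
pose A n := \bigcup_(b in [set` s n]) B b.
have mA n : measurable (A n) by exact: fin_bigcup_measurable.
have AE : \bigcup_(b in P) B b = \bigcup_n A n.
  apply/seteqP; split=> x.
    move=> [b Pb Bx]; exists b.+1 => //; exists b => //=.
    by rewrite mem_filter mem_iota add0n ltnSn/= andbT; exact/asboolP.
  move=> [n _ [b /=]]; rewrite mem_filter => /andP[/asboolP Pb _] Bx.
  by exists b.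
have ndA : {homo A : n m / (n <= m)%N >-> (n <= m)%O}.
  move=> n m nm; rewrite subsetEset => x [b /= + Bx]; rewrite mem_filter.
  move=> /andP[Pb]; rewrite mem_iota/= add0n => bn; exists b => //=.
  by rewrite mem_filter Pb mem_iota/= add0n (leq_trans bn).
have mUA : measurable (\bigcup_n A n) by exact: bigcup_measurable.
have cA := nondecreasing_cvg_mu (mu := la) mA mUA ndA.
rewrite AE -(cvg_lim _ cA)//; apply: lime_le; first by apply/cvg_ex; eexists; exact: cA.
apply: nearW => n /=; apply: vitali_measure_finite => // b.
by rewrite mem_filter => /andP[/asboolP].
Qed.

End vitali.

(** * Strong type from level sets *)

Section levels.
Context (R : realType).
Implicit Types (a r x y : R).

(** For [1 < a] and [0 < y], level k is a^k < y <= a^(k+1): open on the left, hence a ceiling minus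
    one. *)
Definition lev a y : int := Num.ceil (ln y / ln a) - 1.

Lemma levP a y : 1 < a -> 0 < y ->
  a `^ (lev a y)%:~R < y <= a `^ (lev a y + 1)%:~R.
Proof.
move=> a1 y0; have lna : 0 < ln a by rewrite ln_gt0.
have a0 : a != 0 by rewrite gt_eqF// (lt_trans _ a1).
rewrite /powR (negbTE a0) -[y in _ < y](lnK y0) -[y in y <= _](lnK y0).
rewrite ltr_expR ler_expR -ltr_pdivlMr// -ler_pdivrMr// /lev subrK.
exact: ceil_itv.
Qed.

Lemma lev_unique a y (k : int) : 1 < a ->
  a `^ k%:~R < y <= a `^ (k + 1)%:~R -> lev a y = k.
Proof.
move=> a1 /andP[ky yk]; have y0 : 0 < y by rewrite (le_lt_trans _ ky)// powR_ge0.
have /andP[ly yl] := levP a1 y0.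
have lt_exp (i j : int) : a `^ i%:~R < a `^ j%:~R -> i < j.
  rewrite !ltNge => ij; apply: contra ij => ij.
  by apply: ler_powR (ltW a1) _ _ _; rewrite ler_int.
have := lt_exp _ _ (lt_le_trans ly yk); have := lt_exp _ _ (lt_le_trans ky yl).
by move: (lev a y) => l; lia.
Qed.

Lemma sum_powR_int_le r (J : seq int) (m : int) : 1 < r -> uniq J ->
  (forall j, j \in J -> j <= m) ->
  \sum_(j <- J) r `^ j%:~R <= r `^ m%:~R * (r / (r - 1)).
Proof.
move=> r1 uJ Jm; have r0 : 0 < r by rewrite (lt_trans _ r1).
have [n Jn] : exists n : nat, forall j, j \in J -> m - n%:Z < j.
  elim: J {uJ Jm} => [|a J [n IH]]; first by exists 0%N.
  exists (maxn n `|m - a|.+1) => j; rewrite inE => /predU1P[->|/IH]; lia.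
(* Induction on the length of a window ]m - n, m] containing [J]: remove [m] if it is present and
   apply the claim to [m - 1]. *)
elim: n m J uJ Jm Jn => [|n IH] m J uJ Jm Jn.
  have -> : J = [::].
    by case: J Jm Jn {uJ} => // j J /(_ j) + /(_ j); rewrite mem_head; lia.
  by rewrite big_nil mulr_ge0 ?powR_ge0// divr_ge0 ?subr_ge0 ?ltW.
have := IH (m - 1) (rem m J) (rem_uniq _ uJ).
have -> : r `^ (m - 1)%:~R = r `^ m%:~R / r.
  by rewrite intrB powRB ?(gt_eqF r0) ?implybT// powRr1// ltW.
move=> IH'.
have {}IH' : \sum_(j <- rem m J) r `^ j%:~R <= r `^ m%:~R / r * (r / (r - 1)).
  apply: IH' => j; rewrite mem_rem_uniq// !inE => /andP[jm jJ].
    by have := Jm _ jJ; lia.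
  by have := Jn _ jJ; lia.
have -> : r `^ m%:~R * (r / (r - 1)) = r `^ m%:~R + r `^ m%:~R / r * (r / (r - 1)).
  have rn0 : r != 0 by rewrite gt_eqF.
  have r1n0 : r - 1 != 0 by rewrite subr_eq0 gt_eqF.
  by field; rewrite rn0 r1n0.
have [mJ|mJ] := boolP (m \in J).
  by rewrite (big_rem m)//= lerD2l.
by rewrite -{1}(rem_id mJ) (le_trans IH')// lerDr powR_ge0.
Qed.

Lemma two_powR_gt1 (q : R) : 0 < q -> 1 < 2 `^ q.
Proof.
move=> q0; have {1}<- : 1 `^ q = 1 :> R by rewrite powR1.
by rewrite gt0_ltr_powR// ?nnegrE// ltr1n.
Qed.

(** The factor 2^p comes from the upper end of a level, the next one from the highest contributing
    level, the last from a geometric series of ratio 2^(p-1). *)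
Definition level_const (p : R) : R :=
  2 `^ p * 2 `^ (p - 1) * (2 `^ (p - 1) / (2 `^ (p - 1) - 1)).

Lemma level_const_gt0 (p : R) : 1 < p -> 0 < level_const p.
Proof.
move=> p1; have p10 : 0 < p - 1 by rewrite subr_gt0.
rewrite /level_const !mulr_gt0 ?powR_gt0// invr_gt0 subr_gt0.
by rewrite two_powR_gt1.
Qed.

(** Only levels with 2^(j-1) < y contribute, so [j <= lev 2 y + 1]. As p > 1, their weights grow
    geometrically in [j], and the top one, of order y^(p-1), dominates. *)
Lemma sum_level_le (p y : R) (J : seq int) : 1 < p -> 0 <= y -> uniq J ->
  \sum_(j <- J) (2 `^ ((j + 1)%:~R * p) / 2 `^ j%:~R) *
     (y * (2 `^ (j - 1)%:~R < y)%R%:R) <= level_const p * y `^ p.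
Proof.
move=> p1 y0 uJ; have p10 : 0 < p - 1 by rewrite subr_gt0.
have [->|yn0] := eqVneq y 0.
  rewrite big1 => [|j _]; last by rewrite mul0r mulr0.
  exact: mulr_ge0 (ltW (level_const_gt0 p1)) (powR_ge0 _ _).
have {yn0}y0' : 0 < y by rewrite lt_neqAle eq_sym yn0.
pose q : R := 2 `^ (p - 1).
have q1 : 1 < q by rewrite two_powR_gt1.
have /andP[ly yl] := levP (a:=2) (ltr1n R 2) y0'.
have qE (j : int) : 2 `^ ((j + 1)%:~R * p) / 2 `^ j%:~R = 2 `^ p * q `^ j%:~R.
  rewrite /q -powRrM -powRB ?pnatr_eq0 ?implybT// -powRD ?pnatr_eq0 ?implybT//.
  by congr (_ `^ _); rewrite intrD; ring.
under eq_bigr do rewrite qE.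
rewrite (bigID (fun j : int => 2 `^ (j - 1)%:~R < y))/= [X in _ + X]big1 ?addr0; last first.
  by move=> j /negbTE ->; rewrite !mulr0.
rewrite (eq_bigr (fun j : int => 2 `^ p * y * q `^ j%:~R)); last first.
  by move=> j ->; rewrite mulr1; ring.
rewrite -mulr_sumr -big_filter.
set J' := seq.filter _ J.
have J'le j : j \in J' -> j <= lev 2 y + 1.
  rewrite mem_filter => /andP[jy _].
  rewrite leNgt; apply/negP => jl.
  have : y < y; last by rewrite ltxx.
  apply: le_lt_trans yl (le_lt_trans _ jy).
  by rewrite ler_powR ?ler1n// ler_int; lia.
have /le_trans geo := sum_powR_int_le q1 (filter_uniq _ uJ) J'le.
have q_gt0 : 0 < q by rewrite (lt_trans _ q1).
have ql : q `^ (lev 2 y + 1)%:~R <= q * y `^ (p - 1).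
  rewrite intrD (@powRD _ q) ?(gt_eqF q_gt0) ?implybT// powRr1 ?(ltW q_gt0)//.
  rewrite mulrC ler_wpM2l ?(ltW q_gt0)// /q powRAC.
  by rewrite ge0_ler_powR ?nnegrE ?powR_ge0// ltW.
have {geo} := geo _ (ler_wpM2r _ ql).
have q0 : 0 <= q / (q - 1) by rewrite divr_ge0 ?subr_ge0 ?ltW// (lt_trans _ q1).
move=> /(_ q0) geo.
have -> : level_const p * y `^ p = 2 `^ p * y * (q * y `^ (p - 1) * (q / (q - 1))).
  by rewrite -(mulr_powRB1 y0 (lt_trans ltr01 p1)) /level_const -/q; ring.
by rewrite ler_wpM2l ?mulr_ge0 ?powR_ge0.
Qed.

End levels.

(** * Marcinkiewicz interpolation in dyadic form *)

Section upper_part.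
Context d (T : measurableType d) (R : realType) (g : T -> R).
Hypothesis mg : measurable_fun setT g.
Hypothesis g0 : forall x, 0 <= g x.

Definition upper (t : R) (x : T) : R := g x * (t < g x)%R%:R.

Lemma measurable_upper t : measurable_fun setT (upper t).
Proof.
rewrite (_ : upper t = g \* \1_(g @^-1` `]t, +oo[)).
  apply: measurable_funM => //; apply: measurable_indic.
  by rewrite -[X in measurable X]setTI; apply: mg.
apply/funext => x; rewrite /upper/= indicE.
suff -> : (x \in g @^-1` `]t, +oo[) = (t < g x) by [].
by apply/idP/idP; rewrite inE/= in_itv/= andbT.
Qed.

Lemma upper_ge0 t x : 0 <= upper t x.
Proof. by rewrite mulr_ge0. Qed.

(** On level [j] the factor a^p is at most 2^((j+1)p), and the weak type hypothesis sees only the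
    part of [g] above 2^(j-1); the sum over [j] is then carried out pointwise under the integral.
    The masses [m] stay abstract so that both the strong type bound and the Carleson embedding
    follow. *)
Lemma level_sum (sigma : {measure set T -> \bar R}) (p K : R) (F : seq nat)
    (a : nat -> R) (m : nat -> \bar R) : 1 < p -> 0 <= K ->
  (forall b, b \in F -> 0 < a b) -> (forall b, 0 <= m b)%E ->
  (forall j : int, \sum_(b <- F | lev 2 (a b) == j) m b <=
     (K / 2 `^ j%:~R)%:E * \int[sigma]_x (upper (2 `^ (j - 1)%:~R) x)%:E)%E ->
  (\sum_(b <- F) (a b `^ p)%:E * m b <=
     (K * level_const p)%:E * \int[sigma]_x (g x `^ p)%:E)%E.
Proof.
move=> p1 K0 a0 m0 mle; have p0 : 0 < p by rewrite (lt_trans ltr01).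
pose J := undup [seq lev 2 (a b) | b <- F].
have -> : (\sum_(b <- F) (a b `^ p)%:E * m b =
    \sum_(j <- J) \sum_(b <- F | lev 2 (a b) == j) (a b `^ p)%:E * m b)%E.
  rewrite (exchange_big_dep xpredT)//= big_seq [RHS]big_seq.
  apply: eq_bigr => b bF; under eq_bigl do rewrite eq_sym.
  rewrite -big_filter filter_pred1_uniq ?undup_uniq ?mem_undup ?big_seq1//.
  by apply: (map_f (fun b => lev 2 (a b))).

apply: (@le_trans _ _ (\sum_(j <- J) \int[sigma]_x
    (K * (2 `^ ((j + 1)%:~R * p) / 2 `^ j%:~R *
     (g x * (2 `^ (j - 1)%:~R < g x)%R%:R)))%:E)%E).
  apply: lee_sum => j _.
  apply: (@le_trans _ _ (\sum_(b <- F | lev 2 (a b) == j)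
      (2 `^ ((j + 1)%:~R * p))%:E * m b)%E).
    rewrite big_seq_cond [leRHS]big_seq_cond; apply: lee_sum => b /andP[bF /eqP bj].
    rewrite lee_wpmul2r// lee_fin powRrM -bj.
    have /andP[_] := levP (a := 2) (ltr1n R 2) (a0 _ bF).
    by apply: ge0_ler_powR; rewrite ?nnegrE ?powR_ge0 ?ltW ?a0.
  rewrite -ge0_sume_distrr//.
  apply: (le_trans (lee_wpmul2l _ (mle j))); first by rewrite lee_fin powR_ge0.
  rewrite muleA -EFinM -ge0_integralZl ?lee_fin ?mulr_ge0 ?powR_ge0//.
  - rewrite le_eqVlt; apply/orP; left; apply/eqP; apply: eq_integral => x _.
    by rewrite -EFinM /upper; congr EFin; ring.
  - exact/measurable_EFinP/measurable_upper.
  - by move=> x _; rewrite lee_fin upper_ge0.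
rewrite -ge0_integral_sum//; last 2 first.
- move=> j; apply/measurable_EFinP; apply: measurable_funM => //.
  by apply: measurable_funM => //; exact: measurable_upper.
- by move=> j x _; rewrite lee_fin !mulr_ge0 ?invr_ge0 ?powR_ge0.
have mp : measurable_fun setT (fun x => (g x `^ p)%:E : \bar R).
  by apply/measurable_EFinP; exact: measurableT_comp (measurable_powR _) mg.
rewrite -ge0_integralZl//; last 2 first.
- by move=> x _; rewrite lee_fin powR_ge0.
- by rewrite lee_fin mulr_ge0 ?(ltW (level_const_gt0 p1)).
apply: ge0_le_integral => //.
- move=> x _; apply: sume_ge0 => j _.
  by rewrite lee_fin !mulr_ge0 ?invr_ge0 ?powR_ge0.
- apply: emeasurable_sum => j; apply/measurable_EFinP; apply: measurable_funM => //.
  by apply: measurable_funM => //; exact: measurable_upper.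
- exact: measurable_funeM.
- move=> x _; rewrite sumEFin -EFinM lee_fin -mulr_sumr -mulrA ler_wpM2l//.
  by apply: sum_level_le; rewrite ?undup_uniq.
Qed.

End upper_part.

(** * Strong type bound for averages over dilates *)

Section strong_type.
Context d (T : measurableType d) (R : realType) (B : nat -> set T).
Variables (rk : nat -> int) (dil : nat -> nat).
Hypothesis mB : forall b, measurable (B b).
Hypothesis subB : forall b, B b `<=` B (dil b).
Hypothesis vitali : forall b b', B b `&` B b' !=set0 -> rk b <= rk b' ->
  B b `<=` B (dil b').

(** Vitali selection inside each level of base [c] linearizes the maximum: the ball attaining it at
    [x] lies in the dilate of a selected ball of the same level, whose coefficient is smaller by a
    factor of at most [c]. *)
Lemma fmax_powR_le (c p : R) (s : seq nat) (beta : nat -> R) : 1 < c -> 0 < p ->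
  exists F : seq nat, [/\ uniq F, {subset F <= s}, forall b, b \in F -> 0 < beta b,
    forall b b', b \in F -> b' \in F -> b != b' ->
      lev c (beta b) = lev c (beta b') -> B b `&` B b' = set0 &
    forall x, fmax B s beta x `^ p <=
      \sum_(b <- F) c `^ p * beta b `^ p * \1_(B (dil b)) x].
Proof.
move=> c1 p0; pose s' := [seq b <- s | `[< B b !=set0 >] && (0 < beta b)].
pose C b b' := `[< B b `&` B b' !=set0 >] && (lev c (beta b) == lev c (beta b')).
have [b|b b'|F [uF Fs dF cF]] := @greedy_selection _ rk C s'.
- rewrite mem_filter => /andP[/andP[/asboolP[x Bx] _] _].
  by rewrite /C eqxx andbT; apply/asboolP; exists x.
- by rewrite /C setIC eq_sym.
have Fpos b : b \in F -> 0 < beta b.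
  by move=> /Fs; rewrite mem_filter => /andP[/andP[]].
exists F; split => //.
- by move=> b /Fs; rewrite mem_filter => /andP[].
- move=> b b' bF b'F /(dF _ _ bF b'F); rewrite /C => + /eqP bb'.
  by rewrite bb' andbT => /asboolPn/set0P/negP; rewrite negbK => /eqP.
- move=> x; have t0 b : 0 <= c `^ p * beta b `^ p * \1_(B (dil b)) x.
    by rewrite !mulr_ge0 ?powR_ge0.
  have [x0|] := ltP 0 (fmax B s beta x); last first.
    rewrite le_eqVlt ltNge fmax_ge0 orbF => /eqP ->.
    by rewrite powR0 ?gt_eqF// sumr_ge0.
  have [b [bs Bx xb]] := fmax_attained x0.
  have b0 : 0 < beta b by rewrite -xb.
  have [|b' b'F /andP[/andP[/asboolP Cb /eqP bb'] rb]] := cF b.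
    by rewrite mem_filter bs b0 !andbT; apply/asboolP; exists x.
  rewrite (big_rem b')//= -[leLHS]addr0 lerD ?sumr_ge0//.
  rewrite indicE mem_set ?mulr1; last exact: vitali Bx.
  have c0 : 0 < c by rewrite (lt_trans _ c1).
  have b'0 := Fpos _ b'F.
  have <- : (c * beta b') `^ p = c `^ p * beta b' `^ p by rewrite powRM// ltW.
  rewrite xb ge0_ler_powR ?nnegrE ?mulr_ge0 ?(ltW b0) ?(ltW b'0) ?(ltW c0) ?(ltW p0)//.
  have /andP[_] := levP c1 b0; rewrite bb' => /le_trans; apply.
  have /andP[+ _] := levP c1 b'0.
  rewrite intrD (@powRD _ c) ?(gt_eqF c0) ?implybT// powRr1 ?(ltW c0)//.
  by rewrite [leRHS]mulrC ler_pM2r// => /ltW.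
Qed.

Variable la : {measure set T -> \bar R}.
Hypothesis la_fin : forall b, (la (B b) < +oo)%E.
Variable g : T -> R.
Hypothesis mg : measurable_fun setT g.
Hypothesis g0 : forall x, 0 <= g x.

(* Dividing by the measure of the dilated ball is what makes Vitali's argument
   work for measures that are not doubling. *)
Definition dil_average (b : nat) : R :=
  fine (\int[la]_(x in B b) (g x)%:E) / fine (la (B (dil b))).

Lemma dil_average_ge0 b : 0 <= dil_average b.
Proof.
apply: divr_ge0; apply: fine_ge0 => //.
apply: integral_ge0 => x _; rewrite lee_fin. exact: g0.
Qed.

(** The part of [g] up to t/2 contributes at most t/2 times the measure of the dilate, half of what
    the integral exceeds; the part above t/2 must carry the rest. *)
Lemma dil_average_upper (t : R) b : 0 < t -> t < dil_average b ->
  (la (B (dil b)) <= (2 / t)%:E * \int[la]_(x in B b) (upper g (t / 2) x)%:E)%E.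
Proof.
move=> t0; rewrite /dil_average; set M := la _; set I := (\int[la]_(x in _) _)%E => tI.
have mgE D : measurable_fun D (fun x => (g x)%:E) by exact/measurable_funTS/measurable_EFinP.
have muE u D : measurable_fun D (fun x => (upper g u x)%:E).
  by apply/measurable_funTS/measurable_EFinP; exact: measurable_upper.
have M_ge0 : (0 <= M)%E by exact: measure_ge0.
have Mfin : M \is a fin_num by rewrite ge0_fin_numE ?la_fin.
have M0 : 0 < fine M.
  rewrite lt_neqAle fine_ge0// andbT; apply: contraTneq tI => <-.
  by rewrite invr0 mulr0 ltNge ltW.
have It : t * fine M < fine I by rewrite -ltr_pdivlMr.
(* An infinite integral would have [fine] equal to 0 and could not exceed [t * fine M]. *)
have Ifin : I \is a fin_num.
  apply: contraTT It => /fin_numPn nI; rewrite -leNgt.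
  suff -> : fine I = 0 by exact: mulr_ge0 (ltW t0) (ltW M0).
  by case: nI => ->.
set U := (\int[la]_(x in _) _)%E.
have IU : (I <= U + (t / 2)%:E * M)%E.
  apply: (@le_trans _ _ (U + (t / 2)%:E * la (B b)))%E; last first.
    rewrite leeD2l// lee_wpmul2l// ?lee_fin ?divr_ge0 ?(ltW t0)//.
    by apply: le_measure; rewrite ?inE.
  have t20 : 0 <= t / 2 by rewrite divr_ge0// ltW.
  have -> : (U + (t / 2)%:E * la (B b) =
      \int[la]_(x in B b) ((upper g (t / 2) x)%:E + (t / 2)%:E))%E.
    rewrite ge0_integralD//; first by congr (_ + _)%E; rewrite integral_cst.
    by move=> x _; rewrite lee_fin upper_ge0.
  rewrite /I; apply: ge0_le_integral => //.
  - by move=> x _; rewrite lee_fin.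
  - exact: emeasurable_funD.
  - move=> x _; rewrite -EFinD lee_fin /upper; case: ltP => //= xt.
      by rewrite mulr1 lerDl.
    by rewrite mulr0 add0r.
have [Uy|Uy] := eqVneq U +oo%E.
  by rewrite Uy gt0_muley ?leey// lte_fin divr_gt0.
have U0 : (0 <= U)%E by apply: integral_ge0 => x _; rewrite lee_fin upper_ge0.
have Ufin : U \is a fin_num by rewrite ge0_fin_numE// ltey.
move: IU; rewrite -(fineK Ifin) -(fineK Mfin) -(fineK Ufin).
rewrite -!EFinM -EFinD !lee_fin => IU.
have : t * fine M < fine U + t / 2 * fine M by exact: lt_le_trans IU.
move=> H; rewrite -ler_pdivrMl ?divr_gt0// invf_div; lra.
Qed.

(** 2^p is the cost of the selection with base 2, and the factor 2 that of [dil_average_upper]. *)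
Definition strong_const (p : R) : R := 2 `^ p * (2 * level_const p).

Lemma strong_const_gt0 p : 1 < p -> 0 < strong_const p.
Proof.
by move=> p1; apply: mulr_gt0; rewrite ?powR_gt0// pmulr_rgt0// level_const_gt0.
Qed.

(** Selected balls of one level are disjoint, so summing [dil_average_upper] over a level gives the
    weak type bound that [level_sum] asks for, with K = 2. *)
Lemma fmax_strong (p : R) (s : seq nat) : 1 < p ->
  (\int[la]_x (fmax B s dil_average x `^ p)%:E <=
   (strong_const p)%:E * \int[la]_x (g x `^ p)%:E)%E.
Proof.
move=> p1; have p0 : 0 < p by rewrite (lt_trans ltr01).
have [F [uF Fs F0 dF leF]] := fmax_powR_le s dil_average (ltr1n R 2) p0.
have muE u D : measurable_fun D (fun x => (upper g u x)%:E).
  by apply/measurable_funTS/measurable_EFinP; exact: measurable_upper.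
apply: (@le_trans _ _ ((2 `^ p)%:E *
   \sum_(b <- F) (dil_average b `^ p)%:E * la (B (dil b)))%E).
  rewrite ge0_sume_distrr; last by move=> b _; rewrite mule_ge0 ?lee_fin ?powR_ge0.
  under eq_bigr do rewrite muleA -EFinM.
  apply: integral_le_sum_indic leF => //.
  - by apply: measurableT_comp (measurable_powR _) _; exact: measurable_fmax.
  - by move=> x; rewrite powR_ge0.
  - by move=> b; rewrite mulr_ge0 ?powR_ge0.
rewrite /strong_const EFinM -muleA lee_wpmul2l ?lee_fin ?powR_ge0//.
apply: level_sum => // j.
apply: (@le_trans _ _ (\sum_(b <- [seq b <- F | lev 2 (dil_average b) == j])
   (2 / 2 `^ j%:~R)%:E * \int[la]_(x in B b) (upper g (2 `^ (j - 1)%:~R) x)%:E)%E).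
  rewrite -big_filter big_seq [leRHS]big_seq; apply: lee_sum => b.
  rewrite mem_filter => /andP[/eqP bj bF].
  have -> : 2 `^ (j - 1)%:~R = 2 `^ j%:~R / 2 :> R.
    by rewrite intrB (@powRB _ 2) ?pnatr_eq0 ?implybT// powRr1.
  apply: dil_average_upper; first by rewrite powR_gt0.
  by have /andP[] := levP (a := 2) (ltr1n R 2) (F0 _ bF); rewrite bj.
rewrite -ge0_sume_distrr; last first.
  by move=> b _; apply: integral_ge0 => x _; rewrite lee_fin upper_ge0.
rewrite lee_wpmul2l ?lee_fin ?divr_ge0 ?powR_ge0//.
rewrite -[leRHS]mul1e; apply: sum_integral_overlap => //.
  by move=> x _; rewrite lee_fin upper_ge0.
move=> x _; apply: sum_indic_disjoint; first exact: filter_uniq.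
move=> b b'; rewrite !mem_filter => /andP[/eqP bj bF] /andP[/eqP b'j b'F] bb'.
by apply: dF => //; rewrite bj b'j.
Qed.

End strong_type.

Lemma density_eq0 d (T : measurableType d) (R : realType)
    (mu : {measure set T -> \bar R}) (v : T -> R) (A : set T) :
  measurable_fun setT v -> (forall x, 0 < v x) -> measurable A ->
  (\int[mu]_(x in A) (v x)%:E = 0 -> mu A = 0)%E.
Proof.
move=> mv v0 mA.
under eq_integral do rewrite -[X in X%:E]ger0_norm ?(ltW (v0 _))// -abse_EFin.
move=> /(ae_eq_integral_abs mu mA)-/(_ _)[|N [mN N0 AN]].
  exact/measurable_funTS/measurable_EFinP.
apply: (subset_measure0 mA mN _ N0) => x Ax; apply: AN => /= /(_ Ax)/eqP.
by rewrite eqe gt_eqF.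
Qed.

Section induced_measure.
Local Open Scope ereal_scope.
Context d (T : measurableType d) (R : realType) (mu : {measure set T -> \bar R}).
Variable f : T -> \bar R.

(** The two proofs are arguments so that the measure structure can be attached to this function. *)
Definition induced_measure of measurable_fun setT f & (forall x, 0 <= f x) :=
  fun A => \int[mu]_(x in A) f x.

Variables (mf : measurable_fun setT f) (f0 : forall x, 0 <= f x).

Let im0 : induced_measure mf f0 set0 = 0.
Proof. exact: integral_set0. Qed.

Let im_ge0 A : 0 <= induced_measure mf f0 A.
Proof. by apply: integral_ge0 => x _; exact: f0. Qed.

Let im_sigma_additive : semi_sigma_additive (induced_measure mf f0).
Proof. exact: semi_sigma_additive_nng_induced. Qed.

HB.instance Definition _ := isMeasure.Build _ _ _ (induced_measure mf f0)
  im0 im_ge0 im_sigma_additive.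

End induced_measure.

Lemma same_parity_gap (m n : int) : odd `|m|%N = odd `|n|%N -> m != n ->
  n < m + 2 -> n + 2 <= m.
Proof.
move=> mn nm lt; have [//|lt'] := leP (n + 2) m.
have [e|[e|e]] : m = n + 1 \/ (m = n - 1 \/ m = n) by lia.
- by move: mn; rewrite e; lia.
- by move: mn; rewrite e; lia.
- by rewrite e eqxx in nm.
Qed.

(** * Comparing integrals of functions that may fail to be measurable *)

Section lower_integral.
Local Open Scope ereal_scope.
Context d (T : measurableType d) (R : realType) (mu : {measure set T -> \bar R}).
Implicit Types f h : T -> \bar R.

Import HBNNSimple.

(* The smaller, respectively the larger, function need not be measurable: the
   integral of a nonnegative function is a supremum over simple functions. *)
Lemma integral_le_nonmeasurable D f h : (forall x, 0 <= f x) ->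
  (forall x, D x -> f x <= h x) -> \int[mu]_(x in D) f x <= \int[mu]_(x in D) h x.
Proof.
move=> f0 fh; rewrite !ge0_integralE//; last first.
  by move=> x Dx; exact: le_trans (fh _ Dx).
apply: le_ereal_sup => _ [u /= uf <-]; exists u => // x.
apply: le_trans (uf x) _; rewrite /patch; case: ifPn => // /[!inE]; exact: fh.
Qed.

Lemma integral_le_ae f h : (forall x, 0 <= f x) -> measurable_fun setT h ->
  (forall x, 0 <= h x) -> {ae mu, forall x, f x <= h x} ->
  \int[mu]_x f x <= \int[mu]_x h x.
Proof.
move=> f0 mh h0 fh; rewrite ge0_integralTE//; apply: ge_ereal_sup => _ [u /= uf <-].
rewrite -integralT_nnsfun; apply: ae_ge0_le_integral => //.
- by move=> x _; rewrite lee_fin.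
- exact/measurable_EFinP.
- by apply: filterS fh => x fhx _; exact: le_trans (uf x) fhx.
Qed.

End lower_integral.

(** * Passage to countably many balls *)

Section sup_fmax.
Context d (T : measurableType d) (R : realType) (B : nat -> set T).
Hypothesis mB : forall b, measurable (B b).

Definition sup_fmax (beta : nat -> R) (x : T) : \bar R :=
  ereal_sup (range (fun n => (fmax B (iota 0 n) beta x)%:E)).

Lemma sup_fmax_ge beta b x : B b x -> ((beta b)%:E <= sup_fmax beta x)%E.
Proof.
move=> Bx; apply: ereal_sup_ge; exists (fmax B (iota 0 b.+1) beta x)%:E => //.
by rewrite lee_fin fmax_ge// mem_iota/= add0n.
Qed.

Lemma sup_fmax_ge0 beta x : (0 <= sup_fmax beta x)%E.
Proof.
apply: ereal_sup_ge; exists (fmax B (iota 0 0) beta x)%:E => //.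
by rewrite lee_fin fmax_ge0.
Qed.

Lemma sup_fmax_le beta x y : (0 <= y)%E ->
  (forall b, B b x -> ((beta b)%:E <= y)%E) -> (sup_fmax beta x <= y)%E.
Proof.
move=> y0 yP; apply: ge_ereal_sup => _ [n _ <-].
have [x0|] := ltP 0 (fmax B (iota 0 n) beta x).
  by have [b [_ Bx ->]] := fmax_attained x0; exact: yP.
by move=> x0; apply: le_trans y0; rewrite lee_fin.
Qed.

(** Monotone convergence. The limit of the powers is supplied as a measurable majorant [H], the form
    in which [integral_le_ae] can use it. *)
Lemma integral_sup_fmax (la : {measure set T -> \bar R}) beta (p : R) (K : \bar R) :
  0 < p ->
  (forall n, (\int[la]_x (fmax B (iota 0 n) beta x `^ p)%:E <= K)%E) ->
  exists H : T -> \bar R, [/\ measurable_fun setT H, forall x, (0 <= H x)%E,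
    (\int[la]_x H x <= K)%E & forall x, (sup_fmax beta x `^ p <= H x)%E].
Proof.
move=> p0 leK; pose u n x := (fmax B (iota 0 n) beta x `^ p)%:E.
have mu n : measurable_fun setT (u n).
  apply/measurable_EFinP; apply: measurableT_comp (measurable_powR _) _.
  exact: measurable_fmax.
have u0 n x : (0 <= u n x)%E by rewrite lee_fin powR_ge0.
have ndu x : {homo u ^~ x : n m / (n <= m)%N >-> (n <= m)%E}.
  move=> n m nm; rewrite lee_fin ge0_ler_powR ?nnegrE ?fmax_ge0 ?(ltW p0)//.
  apply: fmax_le; first exact: fmax_ge0.
  move=> b; rewrite mem_iota/= add0n => bn Bx; apply: fmax_ge => //.
  by rewrite mem_iota/= add0n (leq_trans bn).
have cvu x : limn (u ^~ x) = ereal_sup (range (u ^~ x)).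
  exact: (cvg_lim _ (ereal_nondecreasing_cvgn (ndu x))).
exists (fun x => limn (u ^~ x)); split.
- apply: (emeasurable_fun_cvg u) => // x _.
  by rewrite cvu; exact: (ereal_nondecreasing_cvgn (ndu x)).
- by move=> x; rewrite cvu; apply: ereal_sup_ge; exists (u 0%N x).
- rewrite monotone_convergence//; apply: lime_le.
    apply: ereal_nondecreasing_is_cvgn => n m nm; apply: ge0_le_integral => //.
    by move=> x _; exact: ndu.
  exact: nearW.
- move=> x; rewrite cvu; set L := ereal_sup _.
  have L0 : (0 <= L)%E by apply: ereal_sup_ge; exists (u 0%N x).
  have uL n : (u n x <= L)%E by apply: ereal_sup_ubound; exists n.
  case: L L0 uL => [L| |//]; last by move=> _ _; rewrite leey.
  rewrite lee_fin => L0 uL.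
  have : (sup_fmax beta x <= (L `^ p^-1)%:E)%E.
    apply: ge_ereal_sup => _ [n _ <-]; rewrite lee_fin.
    have := uL n; rewrite lee_fin => uLn.
    have pn0 : p != 0 by rewrite gt_eqF.
    rewrite -[leLHS](powRr1 (fmax_ge0 _ _ _ _)) -(mulfV pn0) powRrM.
    by rewrite ge0_ler_powR ?nnegrE ?powR_ge0 ?invr_ge0 ?(ltW p0).
  move=> /(gt0_ler_poweR (ltW p0)); rewrite !in_itv/= !leey !andbT.
  rewrite sup_fmax_ge0 lee_fin powR_ge0 => /(_ isT isT)/le_trans; apply.
  by rewrite -powRrM mulVf ?gt_eqF// powRr1.
Qed.

End sup_fmax.

(** * Weighted bounds for an engulfing family of balls *)

Section weights_core.
Context d (T : measurableType d) (R : realType).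
Variables (mu om sig : {measure set T -> \bar R}) (kappa : R) (B : nat -> set T).
Variables (rk : nat -> int) (dil : nat -> nat).
Hypothesis eng : engulfing mu kappa B rk dil.
Variable p : R.
Hypothesis p1 : 1 < p.
Variable v : T -> R.
Hypothesis mv : measurable_fun setT v.
Hypothesis v_gt0 : forall x, 0 < v x.
Hypothesis omE : forall A, measurable A -> om A = (\int[mu]_(x in A) (v x)%:E)%E.
Hypothesis sigE : forall A, measurable A ->
  sig A = (\int[mu]_(x in A) (v x `^ (- (p - 1)^-1))%:E)%E.
Hypothesis om_fin : forall b, (om (B b) < +oo)%E.
Hypothesis sig_fin : forall b, (sig (B b) < +oo)%E.
Variable W : R.
Hypothesis W0 : 0 <= W.
Hypothesis ApW : forall b,
  fine (om (B b)) * fine (sig (B b)) `^ (p - 1) <= W * fine (mu (B b)) `^ p.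
Variable g : T -> R.
Hypothesis mg : measurable_fun setT g.
Hypothesis g0 : forall x, 0 <= g x.
Hypothesis gp : (\int[sig]_x (g x `^ p)%:E < +oo)%E.

(** The conjugate exponent p'. The identity (p-1) q = p turns L^q bounds for N^(p-1) into L^p bounds
    for N, and 1 - q is the exponent of the dual weight. *)
Let q := p / (p - 1).
Let p10 : 0 < p - 1. Proof. by rewrite subr_gt0. Qed.

Let p0 : 0 < p. Proof. exact: lt_trans p1. Qed.

Let q1 : 1 < q. Proof. by rewrite /q ltr_pdivlMr// mul1r ltrBlDr ltrDl. Qed.

Let q0 : 0 < q. Proof. exact: lt_trans q1. Qed.

Let pq : (p - 1) * q = p. Proof. by rewrite /q mulrC divfK// gt_eqF. Qed.

Let qe : 1 - q = - (p - 1)^-1.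
Proof. by rewrite /q; field; rewrite gt_eqF. Qed.

Let mB := eng_measurable eng.
Let mvp e : measurable_fun setT (fun x => v x `^ e).
Proof. exact: measurableT_comp (measurable_powR _) mv. Qed.

Let mu_fin b : mu (B b) \is a fin_num.
Proof. by rewrite ge0_fin_numE ?(eng_fin eng). Qed.

Lemma om_gt0 b : 0 < fine (mu (B b)) -> 0 < fine (om (B b)).
Proof.
move=> m0; rewrite lt_neqAle fine_ge0// andbT eq_sym.
apply: contraTneq m0 => /eqP.
rewrite fine_eq0; last by rewrite ge0_fin_numE.
rewrite omE// => /eqP /density_eq0 -> //.
by rewrite ltxx.
Qed.

Lemma sig_gt0 b : 0 < fine (mu (B b)) -> 0 < fine (sig (B b)).
Proof.
move=> m0; rewrite lt_neqAle fine_ge0// andbT eq_sym.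
apply: contraTneq m0 => /eqP.
rewrite fine_eq0; last by rewrite ge0_fin_numE.
rewrite sigE// => /eqP /density_eq0 -> //; last by move=> x; rewrite powR_gt0.
by rewrite ltxx.
Qed.

(** With f = g sigma this is the average of f with respect to [mu]; it is 0 on a null ball. *)
Definition avg b : R := fine (\int[sig]_(x in B b) (g x)%:E)%E / fine (mu (B b)).

(** From g <= 1 + g^p and the finiteness of [sig] on balls. *)
Lemma integral_ball_fin b : (\int[sig]_(x in B b) (g x)%:E)%E \is a fin_num.
Proof.
rewrite ge0_fin_numE; last by apply: integral_ge0 => x _; rewrite lee_fin.
have mgp : measurable_fun (B b) (fun x => (g x `^ p)%:E).
  apply/measurable_funTS/measurable_EFinP.
  exact: measurableT_comp (measurable_powR _) mg.
apply: (@le_lt_trans _ _ (\int[sig]_(x in B b) (1 + (g x `^ p)%:E))%E).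
  apply: ge0_le_integral => //.
  - by move=> x _; rewrite lee_fin.
  - exact/measurable_funTS/measurable_EFinP.
  - exact: emeasurable_funD.
  - move=> x _; rewrite -EFinD lee_fin.
    have [x1|x1] := leP 1 (g x).
      by rewrite (le_trans (le1r_powR x1 (ltW p1)))// lerDr.
    by rewrite (le_trans (ltW x1))// lerDl powR_ge0.
rewrite ge0_integralD//; last by move=> x _; rewrite lee_fin powR_ge0.
rewrite integral_cst// mul1e lte_add_pinfty//.
apply: le_lt_trans gp; apply: ge0_subset_integral => //.
- apply/measurable_EFinP; exact: measurableT_comp (measurable_powR _) mg.
- by move=> x _; rewrite lee_fin powR_ge0.
Qed.

Lemma Ap_dil b : fine (om (B (dil b))) * fine (sig (B (dil b))) `^ (p - 1) <=
  W * kappa `^ p * fine (mu (B b)) `^ p.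
Proof.
have k0 : 0 <= kappa by rewrite (le_trans ler01)// (eng_kappa eng).
apply: le_trans (ApW _) _; rewrite -mulrA ler_wpM2l// -powRM ?fine_ge0//.
apply: ge0_ler_powR; rewrite ?nnegrE ?mulr_ge0 ?fine_ge0 ?(ltW p0)//.
rewrite -lee_fin EFinM !fineK//; exact: (eng_doubling eng).
Qed.

(** The factor kappa^p comes from [Ap_dil]; the others bound the maximal functions with respect to
    [om] in L^q and [sig] in L^p. *)
Definition buckley_const : R :=
  (kappa `^ p) `^ q * strong_const q * strong_const p.

(* [h] is chosen so that [h dom = N ^ (p - 1) dmu] and [h ^ q dom = N ^ p dsig]. *)
Lemma buckley_fmax (s : seq nat) :
  (\int[om]_x (fmax B s avg x `^ p)%:E <=
   (W `^ q * buckley_const)%:E * \int[sig]_x (g x `^ p)%:E)%E.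
Proof.
have k0 : 0 <= kappa by rewrite (le_trans ler01)// (eng_kappa eng).
pose al := dil_average B dil sig g.
have al0 b : 0 <= al b by exact: dil_average_ge0.
pose N := fmax B s al.
have mN : measurable_fun setT N by exact: measurable_fmax.
have N0 x : 0 <= N x by exact: fmax_ge0.
pose h x := N x `^ (p - 1) / v x.
have h0 x : 0 <= h x by rewrite divr_ge0 ?powR_ge0// ltW.
have mh : measurable_fun setT h.
  apply: measurable_funM; first exact: measurableT_comp (measurable_powR _) mN.
  rewrite (_ : (fun x => _) = (fun x => v x `^ (-1))); first exact: mvp.
  by apply/funext => x; rewrite powR_inv1// ltW.
pose ga := dil_average B dil om h.
have hE b : (\int[om]_(x in B b) (h x)%:E = \int[mu]_(x in B b) (N x `^ (p - 1))%:E)%E.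
  rewrite (integral_density mv (fun x => ltW (v_gt0 x)) omE)//; last 2 first.
  - by move=> x _; rewrite lee_fin.
  - exact/measurable_funTS/measurable_EFinP.
  by apply: eq_integral => x _; rewrite -EFinM divfK// gt_eqF.
(* A crude bound, used only to make integrals over balls finite. *)
have NM x : N x <= \sum_(b <- s) al b.
  apply: fmax_le => [|b bs _]; first exact: sumr_ge0.
  by rewrite (big_rem b)//= lerDl sumr_ge0.
have mNp e D : measurable_fun D (fun x => (N x `^ e)%:E).
  apply/measurable_funTS/measurable_EFinP.
  exact: measurableT_comp (measurable_powR _) mN.
(* Lerner's inequality on one ball: write avg^(p-1) as al^(p-1) (sig(B (dil b)) / mu(B b))^(p-1),
   bound the second factor by W kappa^p mu(B b) / om(B (dil b)) through [Ap_dil], and use that al b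
   <= N on [B b]. *)
have avgle b : b \in s -> avg b `^ (p - 1) <= W * kappa `^ p * ga b.
  move=> bs; have K0 : 0 <= W * kappa `^ p by rewrite mulr_ge0 ?powR_ge0.
  have [m0|mn0] := eqVneq (fine (mu (B b))) 0.
    rewrite /avg m0 invr0 mulr0 powR0 ?gt_eqF// mulr_ge0//.
    exact: dil_average_ge0.
  have m_gt0 : 0 < fine (mu (B b)) by rewrite lt_neqAle eq_sym mn0 fine_ge0.
  have md : 0 < fine (mu (B (dil b))).
    apply: lt_le_trans m_gt0 _; rewrite fine_le//.
    by apply: le_measure; rewrite ?inE//; exact: (eng_sub eng).
  have om0 := om_gt0 md; have sig0 := sig_gt0 md.
  have Hlow : al b `^ (p - 1) * fine (mu (B b)) <=
      fine (\int[om]_(x in B b) (h x)%:E)%E.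
    rewrite -lee_fin fineK; last first.
      rewrite ge0_fin_numE; last by apply: integral_ge0 => x _; rewrite lee_fin.
      rewrite hE; set M := \sum_(b <- s) al b in NM.
      apply: (@le_lt_trans _ _ (\int[mu]_(x in B b) (M `^ (p - 1))%:E)%E).
        apply: ge0_le_integral => //.
        - by move=> x _; rewrite lee_fin powR_ge0.
        - move=> x _; rewrite lee_fin ge0_ler_powR ?nnegrE ?(ltW p10)//.
          exact: le_trans (NM x).
      by rewrite integral_cst// lte_mul_pinfty ?lee_fin ?powR_ge0// ltey_eq mu_fin.
    rewrite hE EFinM fineK// -integral_cst//; apply: ge0_le_integral => //.
    - by move=> x _; rewrite lee_fin powR_ge0.
    - move=> x Bx; rewrite lee_fin ge0_ler_powR ?nnegrE ?(ltW p10)//.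
      exact: fmax_ge.
  rewrite {1}/ga /dil_average mulrA ler_pdivlMr//.
  apply: le_trans (ler_wpM2l K0 Hlow).
  have -> : avg b = al b * (fine (sig (B (dil b))) / fine (mu (B b))).
    by rewrite /avg /al /dil_average mulrA divfK// gt_eqF.
  have s0 : 0 <= fine (sig (B (dil b))) by exact: ltW.
  have im0 : 0 <= (fine (mu (B b)))^-1 by rewrite invr_ge0 ltW.
  rewrite (powRM _ (al0 b) (mulr_ge0 s0 im0)) -mulrA [leRHS]mulrCA.
  rewrite ler_wpM2l ?powR_ge0// (powRM _ s0 im0).
  have -> : (fine (mu (B b)))^-1 `^ (p - 1) = (fine (mu (B b)) `^ (p - 1))^-1.
    by rewrite -powR_inv1 ?(ltW m_gt0)// powRAC powR_inv1 ?powR_ge0.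
  rewrite mulrAC ler_pdivrMr ?powR_gt0// -[leRHS]mulrA.
  by rewrite mulr_powRB1 ?(ltW m_gt0)// mulrC Ap_dil.
apply: (@le_trans _ _ (((W * kappa `^ p) `^ q)%:E * \int[om]_x (fmax B s ga x `^ q)%:E)%E).
  have mga : measurable_fun setT (fun x => (fmax B s ga x `^ q)%:E).
    apply/measurable_EFinP; apply: measurableT_comp (measurable_powR _) _.
    exact: measurable_fmax.
  rewrite -ge0_integralZl ?lee_fin ?powR_ge0//; last first.
    by move=> x _; rewrite lee_fin powR_ge0.
  apply: ge0_le_integral => //.
  - by move=> x _; rewrite lee_fin powR_ge0.
  - apply/measurable_EFinP; apply: measurableT_comp (measurable_powR _) _.
    exact: measurable_fmax.
  - exact: measurable_funeM.
  move=> x _; rewrite -EFinM lee_fin -powRM ?mulr_ge0 ?powR_ge0 ?fmax_ge0//.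
  have K0 : 0 <= W * kappa `^ p by rewrite mulr_ge0 ?powR_ge0.
  have [x0|] := ltP 0 (fmax B s avg x); last first.
    rewrite le_eqVlt ltNge fmax_ge0 orbF => /eqP ->.
    by rewrite powR0 ?gt_eqF ?powR_ge0.
  have [b [bs Bx ->]] := fmax_attained x0.
  have -> : avg b `^ p = (avg b `^ (p - 1)) `^ q by rewrite -powRrM pq.
  apply: ge0_ler_powR (ltW q0) _ _ _ _ _; rewrite ?nnegrE ?powR_ge0//.
    exact: mulr_ge0 K0 (fmax_ge0 _ _ _ _).
  apply: le_trans (avgle _ bs) _; rewrite ler_wpM2l//.
  exact: fmax_ge.
have hq : (\int[om]_x (h x `^ q)%:E = \int[sig]_x (N x `^ p)%:E)%E.
  rewrite (integral_density mv (fun x => ltW (v_gt0 x)) omE)//; last 2 first.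
  - by move=> x _; rewrite lee_fin powR_ge0.
  - apply/measurable_EFinP; exact: measurableT_comp (measurable_powR _) mh.
  rewrite (integral_density (mvp _) (fun x => powR_ge0 _ _) sigE)//; last first.
    by move=> x _; rewrite lee_fin powR_ge0.
  apply: eq_integral => x _; rewrite -!EFinM; congr EFin.
  rewrite /h powRM ?powR_ge0 ?invr_ge0 ?(ltW (v_gt0 x))// -powRrM pq -mulrA.
  congr (_ * _); rewrite -powR_inv1 ?(ltW (v_gt0 x))// -powRrM.
  rewrite -[X in _ * X](powRr1 (ltW (v_gt0 x))) -powRD ?(gt_eqF (v_gt0 x)) ?implybT//.
  by congr (_ `^ _); rewrite -qe; ring.
apply: (@le_trans _ _ (((W * kappa `^ p) `^ q)%:E *
    ((strong_const q)%:E * ((strong_const p)%:E * \int[sig]_x (g x `^ p)%:E)))%E).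
  rewrite lee_wpmul2l ?lee_fin ?powR_ge0//.
  apply: le_trans (fmax_strong mB (eng_sub eng) (eng_vitali eng) om_fin mh h0 s q1) _.
  rewrite lee_wpmul2l ?lee_fin ?(ltW (strong_const_gt0 q1))// hq.
  exact: (fmax_strong mB (eng_sub eng) (eng_vitali eng) sig_fin mg g0 s p1).
rewrite !muleA -!EFinM lee_wpmul2r//.
  by apply: integral_ge0 => x _; rewrite lee_fin powR_ge0.
rewrite lee_fin powRM ?powR_ge0// /buckley_const le_eqVlt; apply/orP; left.
by apply/eqP; ring.
Qed.

(* With this base the balls two levels above [B b] cover at most
   [kappa ^ 2 / a = 1 / 2] of a good ball [B b]. *)
Let a := 2 * kappa ^+ 2.
Let k1 : 1 <= kappa. Proof. exact: (eng_kappa eng). Qed.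

Let k0 : 0 < kappa. Proof. exact: lt_le_trans k1. Qed.

Let a1 : 1 < a.
Proof. by rewrite /a (@lt_le_trans _ _ 2) ?ltr1n// ler_peMr// expr_ge1// ltW. Qed.

Let a0 : 0 < a. Proof. exact: lt_trans a1. Qed.

Let avg_ge0 b : 0 <= avg b.
Proof. by apply: divr_ge0; apply: fine_ge0 => //; apply: integral_ge0 => x _; rewrite lee_fin. Qed.

Let lv b := lev a (avg b).
(** For k = lv b + 2 this is the union of the balls at least two levels above [B b]. All balls of
    the sequence count, so [E] does not depend on a selected family. *)
Let over (k : int) := \bigcup_(b in [set b | a `^ k%:~R < avg b]) B b.
Let E b := B b `\` over (lv b + 2).

(* Only the point [x] is required to see no larger average; since every dilate of
   [B b] contains [x], the averages over the dilates are controlled as well. *)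
Definition good b : Prop := 0 < avg b /\
  exists2 x, B b x & forall b', B b' x -> avg b' <= a `^ (lv b + 1)%:~R.

Let mover k : measurable (over k).
Proof. by apply: bigcup_measurable => b _. Qed.

Let mE b : measurable (E b).
Proof. exact: measurableD. Qed.

Let EB b : E b `<=` B b. Proof. exact: subDsetl. Qed.

Let mgE D : measurable_fun D (fun x => (g x)%:E).
Proof. exact/measurable_funTS/measurable_EFinP. Qed.

Let gE0 x : (0 <= (g x)%:E)%E. Proof. by rewrite lee_fin. Qed.

(** The measure f dmu, written through f = g sigma. *)
Let Phi : {measure set T -> \bar R} := induced_measure sig (@mgE setT) gE0.

Let Phi_le b b' : B b `<=` B b' -> fine (Phi (B b)) <= fine (Phi (B b')).
Proof.
move=> bb'; rewrite fine_le ?integral_ball_fin//.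
by apply: le_measure; rewrite ?inE.
Qed.

Let avgE b : 0 < fine (mu (B b)) -> fine (Phi (B b)) = avg b * fine (mu (B b)).
Proof. by move=> m0; rewrite /avg divfK// gt_eqF. Qed.

Let avg_gt0_mu b : 0 < avg b -> 0 < fine (mu (B b)).
Proof.
rewrite lt_neqAle => /andP[+ _]; rewrite lt_neqAle fine_ge0// andbT.
by apply: contraNneq => m0; rewrite /avg -m0 invr0 mulr0.
Qed.

Let mu_le b b' : B b `<=` B b' -> fine (mu (B b)) <= fine (mu (B b')).
Proof. by move=> bb'; rewrite fine_le//; apply: le_measure; rewrite ?inE. Qed.

Let mu_dil b : fine (mu (B (dil b))) <= kappa * fine (mu (B b)).
Proof. by rewrite -lee_fin EFinM !fineK//; exact: (eng_doubling eng). Qed.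

Lemma avg_dil b : avg b <= kappa * avg (dil b).
Proof.
have [b0|] := ltP 0 (avg b); last first.
  by move/le_trans; apply; rewrite mulr_ge0// ltW.
have m0 := avg_gt0_mu b0.
have md : 0 < fine (mu (B (dil b))) by rewrite (lt_le_trans m0)// mu_le//; exact: (eng_sub eng).
rewrite -(ler_pM2r m0) -avgE// (le_trans (Phi_le (eng_sub eng (b := b))))//.
rewrite avgE//; apply: le_trans (ler_wpM2l (avg_ge0 _) (mu_dil b)) _.
by rewrite mulrCA mulrA.
Qed.

(** A ball two levels up that meets [B b] cannot have larger rank: its dilate would contain the good
    point, and [avg_dil] would bound its average by kappa a^(lv b + 1), too little since kappa <= a.
    It therefore lies in the dilate of [B b]. Vitali's covering bounds the union of such balls by
    the mass of f on that dilate, whose average the good point controls as well. *)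
Lemma good_sparse b : good b -> fine (mu (B b)) <= 2 * fine (mu (E b)).
Proof.
move=> [b0 [x0 Bx0 x0P]]; have m0 := avg_gt0_mu b0.
have aS (k : int) : a `^ (k + 1)%:~R = a * a `^ k%:~R.
  by rewrite intrD (@powRD _ a) ?(gt_eqF a0) ?implybT// powRr1 ?(ltW a0)// mulrC.
have a2 : a `^ (lv b + 2)%:~R = a * a `^ (lv b + 1)%:~R.
  by rewrite -aS -[in RHS]addrA.
have ka : kappa <= a.
  rewrite /a expr2 (le_trans (ler_peMl (ltW k0) k1))// ler_peMl ?ler1n//.
  by rewrite mulr_ge0 ?ltW.
have md : 0 < fine (mu (B (dil b))).
  by rewrite (lt_le_trans m0)// mu_le//; exact: (eng_sub eng).
pose P := [set b' | a `^ (lv b + 2)%:~R < avg b' /\ B b' `<=` B (dil b)].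
have BP : B b `&` over (lv b + 2) `<=` \bigcup_(b' in P) B b'.
  move=> x [Bx [b' /= hb' B'x]]; exists b' => //; split => //.
  have [rb|rb] := leP (rk b') (rk b).
    by apply: (eng_vitali eng) => //; exists x.
  have Bb' : B b `<=` B (dil b').
    by apply: (eng_vitali eng); [exists x|exact: ltW].
  have := x0P _ (Bb' _ Bx0) => /(ler_wpM2l (ltW k0))/(le_trans (avg_dil b')).
  move=> /(lt_le_trans hb'); rewrite a2 ltr_pM2r ?powR_gt0//.
  by rewrite ltNge ka.
have muP : (mu (B b `&` over (lv b + 2)) <=
    (kappa / a `^ (lv b + 2)%:~R)%:E * Phi (B (dil b)))%E.
  apply: (@le_trans _ _ (mu (\bigcup_(b' in P) B b'))).
    by apply: le_measure; rewrite ?inE//; [exact: measurableI|exact: bigcup_measurable].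
  apply: (vitali_measure (rk := rk) (dil := dil)) => //.
  - exact: (eng_vitali eng).
  - move=> b' [hb' _]; have b'0 : 0 < avg b' by rewrite (le_lt_trans _ hb')// powR_ge0.
    have m'0 := avg_gt0_mu b'0.
    apply: (le_trans (eng_doubling eng b')).
    rewrite -[mu (B b')]fineK// -[Phi _]fineK ?integral_ball_fin// -!EFinM lee_fin.
    rewrite -mulrA ler_wpM2l ?(ltW k0)// avgE// mulrA -[leLHS]mul1r.
    by rewrite ler_pM2r// ler_pdivlMl ?powR_gt0// mulr1 ltW.
  - by move=> b' [].
  - by rewrite divr_ge0 ?powR_ge0// ltW.
have EI : (mu (E b) + mu (B b `&` over (lv b + 2)) = mu (B b))%E.
  rewrite -measureU//; [by rewrite setUC setUIDK| exact: measurableI|].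
  by rewrite /E setDE -setIA [~` _ `&` _]setIC; rewrite -setIA setICr !setI0.
have Efin : mu (E b) \is a fin_num.
  rewrite ge0_fin_numE// (le_lt_trans _ (eng_fin eng b))//.
  by apply: le_measure; rewrite ?inE.
have Ifin : mu (B b `&` over (lv b + 2)) \is a fin_num.
  rewrite ge0_fin_numE// (le_lt_trans _ (eng_fin eng b))//.
  by apply: le_measure; rewrite ?inE//; exact: measurableI.
have {}EI : fine (mu (B b)) = fine (mu (E b)) + fine (mu (B b `&` over (lv b + 2))).
  by rewrite -EI fineD.
suff : fine (mu (B b `&` over (lv b + 2))) <= fine (mu (B b)) / 2 by move=> h; lra.
rewrite -lee_fin fineK// (le_trans muP)// -[Phi _]fineK ?integral_ball_fin// -EFinM lee_fin.
rewrite avgE//.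
have dle : avg (dil b) <= a `^ (lv b + 1)%:~R by apply: x0P; exact: (eng_sub eng).
have := ler_pM (avg_ge0 _) (ltW md) dle (mu_dil b).
have c0 : 0 <= kappa / a `^ (lv b + 2)%:~R by rewrite divr_ge0 ?powR_ge0 ?ltW.
move=> /(ler_wpM2l c0)/le_trans; apply.
have u0 : a `^ (lv b + 1)%:~R != 0 by rewrite gt_eqF ?powR_gt0.
have kn0 : kappa != 0 by rewrite gt_eqF.
rewrite a2 /a le_eqVlt; apply/orP; left; apply/eqP; field.
by rewrite u0 kn0.
Qed.

(** * Carleson embedding for a sparse family of good balls *)

Section sparse_family.
Variable F : seq nat.
Hypothesis uF : uniq F.
Hypothesis goodF : forall b, b \in F -> good b.
Hypothesis disjF : forall b b', b \in F -> b' \in F -> b != b' -> lv b = lv b' ->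
  B b `&` B b' = set0.

Let avg_gt0 b : b \in F -> 0 < avg b. Proof. by move=> /goodF[]. Qed.

Let lv_lt b : b \in F -> a `^ (lv b)%:~R < avg b.
Proof. by move=> /avg_gt0 /(levP a1) /andP[]. Qed.

(* Members of two levels at distance at least 2 have disjoint [E]'s, so at most
   one even level and one odd level meet at a given point. *)
Let sum_E_le2 x : \sum_(b <- F) \1_(E b) x <= 2 :> R.
Proof.
pose par b := odd `|lv b|%N.
have E0 b b' : b \in F -> b' \in F -> lv b + 2 <= lv b' -> E b `&` E b' = set0.
  move=> bF b'F bb'; rewrite -subset0 => y [[_ nb] [B'y _]]; apply: nb.
  exists b' => //=; apply: le_lt_trans (lv_lt b'F).
  by apply: ler_powR (ltW a1) _ _ _; rewrite ler_int.
have one (P : pred nat) : (forall b b', P b -> P b' -> par b = par b') ->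
    \sum_(b <- [seq b <- F | P b]) \1_(E b) x <= 1 :> R.
  move=> Ppar; apply: sum_indic_disjoint; first exact: filter_uniq.
  move=> b b'; rewrite !mem_filter => /andP[Pb bF] /andP[Pb' b'F] bb'.
  have [l|l] := eqVneq (lv b) (lv b').
    rewrite -subset0 => y [/EB By /EB B'y].
    by rewrite -(disjF bF b'F bb' l).
  have := Ppar _ _ Pb Pb'; rewrite /par => pp.
  have [ll|ll] := leP (lv b + 2) (lv b'); first exact: E0.
  rewrite setIC; apply: E0 => //.
  exact: same_parity_gap pp l ll.
rewrite (bigID par)/= -[X in X + _]big_filter -[X in _ + X]big_filter.
rewrite (_ : 2 = 1 + 1 :> R)// lerD//; apply: one => b b'; move=> h h'.
  by rewrite /par in h h' *; rewrite h h'.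
by rewrite /par in h h' *; rewrite (negbTE h) (negbTE h').
Qed.

Variable S : R.
Hypothesis S0 : 0 <= S.
(** The quotient is the average over [B b'] of sigma restricted to [B b], so this is the A_infinity
    condition for sigma tested on finitely many balls. *)
Hypothesis AinfS : forall b n, (\int[mu]_(x in B b)
  (fmax B (iota 0 n)
    (fun b' => fine (sig (B b' `&` B b)) / fine (mu (B b'))) x)%:E <=
  S%:E * sig (B b))%E.

(** On [E b] the maximal function of sigma restricted to [B (dil r)] is at least sig(B (dil b)) /
    mu(B (dil b)), while sparseness and doubling give mu(B (dil b)) <= 2 kappa mu(E b). The sets
    [E b] overlap at most twice, so [AinfS] on [B (dil r)] closes the estimate. *)
Lemma carleson_packing r :
  (\sum_(b <- F | `[< B (dil b) `<=` B (dil r) >]) sig (B (dil b)) <=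
   (4 * kappa * S)%:E * sig (B (dil r)))%E.
Proof.
(* Large enough for the dilates of all members of [F] to be among the tested balls. *)
pose n := (\max_(b <- F) dil b).+1.
pose beta b' := fine (sig (B b' `&` B (dil r))) / fine (mu (B b')).
pose h x := fmax B (iota 0 n) beta x.
have mh : measurable_fun setT h by exact: measurable_fmax.
have mhE D : measurable_fun D (fun x => (h x)%:E) by exact/measurable_funTS/measurable_EFinP.
have h0 x : 0 <= h x by exact: fmax_ge0.
pose F' := [seq b <- F | `[< B (dil b) `<=` B (dil r) >]].
have F'P b : b \in F' -> b \in F /\ B (dil b) `<=` B (dil r).
  by rewrite mem_filter => /andP[/asboolP].
rewrite -big_filter -/F'.
apply: (@le_trans _ _ (\sum_(b <- F') (2 * kappa)%:E * \int[mu]_(x in E b) (h x)%:E)%E).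
  rewrite big_seq [leRHS]big_seq; apply: lee_sum => b bF'.
  have [bF bV] := F'P _ bF'.
  have m0 := avg_gt0_mu (avg_gt0 bF).
  have md : 0 < fine (mu (B (dil b))).
    by rewrite (lt_le_trans m0)// mu_le//; exact: (eng_sub eng).
  pose c := fine (sig (B (dil b))) / fine (mu (B (dil b))).
  have c0 : 0 <= c by rewrite divr_ge0 ?fine_ge0.
  have mEfin : mu (E b) \is a fin_num.
    rewrite ge0_fin_numE// (le_lt_trans _ (eng_fin eng b))//.
    by apply: le_measure; rewrite ?inE.
  apply: (@le_trans _ _ ((2 * kappa)%:E * \int[mu]_(x in E b) c%:E)%E); last first.
    rewrite lee_wpmul2l ?lee_fin ?mulr_ge0 ?(ltW k0)//; apply: ge0_le_integral => //.
    move=> x [Bx _]; rewrite lee_fin.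
    have -> : c = beta (dil b) by rewrite /beta (setIidl bV).
    apply: fmax_ge; last exact: (eng_sub eng).
    by rewrite mem_iota/= add0n ltnS /n (big_rem b)//= leq_maxl.
  rewrite integral_cst// -[mu (E b)]fineK// -[sig _]fineK ?ge0_fin_numE// -!EFinM lee_fin.
  have Em := good_sparse (goodF bF).
  have : fine (mu (B (dil b))) <= 2 * kappa * fine (mu (E b)).
    apply: le_trans (mu_dil b) _; rewrite (mulrC 2) -mulrA.
    exact: ler_wpM2l (ltW k0) _ _ Em.
  move=> /(ler_wpM2l c0); rewrite {1}/c divfK ?gt_eqF//.
  by rewrite mulrCA.
rewrite -ge0_sume_distrr; last first.
  by move=> b _; apply: integral_ge0 => x _; rewrite lee_fin.
have -> : (4 * kappa * S = 2 * kappa * (2 * S))%R by ring.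
rewrite (EFinM (2 * kappa) (2 * S)) -muleA lee_wpmul2l ?lee_fin ?mulr_ge0 ?(ltW k0)//.
apply: (@le_trans _ _ (2%:E * \int[mu]_(x in B (dil r)) (h x)%:E)%E).
  apply: sum_integral_overlap => //.
  - by move=> x _; rewrite lee_fin.
  - move=> b /F'P[_ bV] x /EB Bx; apply: bV; exact: (eng_sub eng).
  - move=> x _; apply: le_trans (sum_E_le2 x).
    rewrite /F' big_filter [leRHS](bigID (fun b => `[< B (dil b) `<=` B (dil r) >]))/=.
    by rewrite lerDl sumr_ge0.
rewrite EFinM -muleA lee_wpmul2l ?lee_fin//.
exact: AinfS.
Qed.

(* Balls of the maximal family through a common point have comparable measures,
   and the sets [E b] take up half of each of them, so there are few of them. *)
Lemma exists_maximal_family (Fj : seq nat) : uniq Fj -> {subset Fj <= F} ->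
  exists M : seq nat, [/\ uniq M, {subset M <= Fj},
    forall b, b \in Fj -> exists2 r, r \in M & B (dil b) `<=` B (dil r) &
    forall x, \sum_(b <- M) \1_(B b) x <= 4 * kappa :> R].
Proof.
move=> uFj FjF.
(* Domination asks for strictly larger rank, so a ball of largest rank among those whose dilate
   contains [B (dil b)] is not dominated. *)
pose dom b b' := (rk b < rk b') && `[< B (dil b) `<=` B (dil b') >].
pose M := [seq b <- Fj | ~~ has (dom b) Fj].
have MP b : b \in M -> b \in Fj /\ ~~ has (dom b) Fj.
  by rewrite mem_filter => /andP[].
exists M; split.
- exact: filter_uniq.
- by move=> b /MP[].
- move=> b bFj; pose s := [seq b' <- Fj | `[< B (dil b) `<=` B (dil b') >]].
  have bs : b \in s by rewrite mem_filter bFj andbT; exact/asboolP.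
  have [|m ms mP] := @max_rank _ rk s; first by apply: contraTneq bs => ->.
  have [/asboolP bm mFj] : `[< B (dil b) `<=` B (dil m) >] /\ m \in Fj.
    by move: ms; rewrite mem_filter => /andP[].
  exists m => //; rewrite mem_filter mFj andbT.
  apply/hasPn => b' b'Fj; apply/negP => /andP[mb' /asboolP mb'S].
  have : b' \in s.
    by rewrite mem_filter b'Fj andbT; apply/asboolP; exact: subset_trans mb'S.
  by move=> /mP; rewrite leNgt mb'.
move=> x; pose Mx := [seq b <- M | x \in B b].
have -> : \sum_(b <- M) \1_(B b) x = (size Mx)%:R :> R.
  by rewrite size_filter -sum1_count natr_sum [RHS]big_mkcond/=;
     apply: eq_bigr => b _; rewrite indicE; case: (x \in B b).
(* The negated rank selects a ball [b0] of least rank through [x]; every ball through [x] is then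
   compared with the single set [B (big b0)]. *)
have [->|/(@max_rank _ (fun b => - rk b))[b0 b0M b0P]] := eqVneq Mx [::].
  by rewrite mulr_ge0// ltW.
have MxP b : b \in Mx -> [/\ B b x, b \in F, b \in Fj & ~~ has (dom b) Fj].
  rewrite mem_filter => /andP[/[!inE] Bx /MP[bFj nb]]; split => //.
  exact: FjF.
have [big bigP] := eng_comparable eng.
have [B0x b0F _ nb0] := MxP _ b0M.
have bigb b : b \in Mx -> B b `<=` B (big b0) /\
    fine (mu (B (big b0))) <= kappa * fine (mu (B b)).
  move=> bM; have [Bx bF bFj nb] := MxP _ bM.
  have [||[lt sub]|[sub le]] := bigP b0 b.
  - by exists x.
  - by rewrite -lerN2; exact: b0P.
  (* Here [b] would dominate [b0], against the choice of [M]. *)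
  - exfalso; move/hasPn: nb0 => /(_ _ bFj)/negP; apply.
    by rewrite /dom lt; exact/asboolP.
  - by split => //; rewrite -lee_fin EFinM !fineK.
have m0 : 0 < fine (mu (B (big b0))).
  by rewrite (lt_le_trans (avg_gt0_mu (avg_gt0 b0F)))// mu_le//; have [] := bigb _ b0M.
have uMx : uniq Mx by rewrite !filter_uniq.
have Efin b : mu (E b) \is a fin_num.
  rewrite ge0_fin_numE// (le_lt_trans _ (eng_fin eng b))//.
  by apply: le_measure; rewrite ?inE.
have sumE : \sum_(b <- Mx) fine (mu (E b)) <= 2 * fine (mu (B (big b0))).
  rewrite -lee_fin EFinM fineK// -sumEFin.
  have := @sum_integral_overlap _ T R _ mu Mx E (B (big b0)) (cst 1%E) 2 mE (mB _)
     (measurable_cst _) (fun _ _ => lee01).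
  rewrite integral_cst// mul1e => H; apply: le_trans (H _ _); last first.
  - move=> y _; apply: le_trans (sum_E_le2 y).
    by apply: ler_sum_subset => // b /MxP[].
  - move=> b bM; apply: subset_trans (EB (b:=b)) _; have [] := bigb _ bM; exact.
  rewrite big_seq [leRHS]big_seq le_eqVlt; apply/orP; left; apply/eqP.
  by apply: eq_bigr => b _; rewrite integral_cst// mul1e fineK.
have : (size Mx)%:R * fine (mu (B (big b0))) <= 4 * kappa * fine (mu (B (big b0))).
  apply: (@le_trans _ _ (\sum_(b <- Mx) 2 * kappa * fine (mu (E b)))).
    rewrite mulr_natl -[(size _)]count_predT -[X in X <= _]addr0 -iter_addr -big_const_seq.
    rewrite big_seq [leRHS]big_seq; apply: ler_sum => b bM.
    have [_] := bigb _ bM; have [_ bF _ _] := MxP _ bM => /le_trans; apply.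
    rewrite (mulrC 2) -mulrA; apply: ler_wpM2l (ltW k0) _ _ _.
    exact: good_sparse (goodF bF).
  rewrite -mulr_sumr; have -> : 4 * kappa * fine (mu (B (big b0))) =
    2 * kappa * (2 * fine (mu (B (big b0)))) by ring.
  by rewrite ler_wpM2l// mulr_ge0// ltW.
by rewrite ler_pM2r.
Qed.

Let al := dil_average B dil sig g.

Lemma al_gt0 b : b \in F -> 0 < al b.
Proof.
move=> bF; have b0 := avg_gt0 bF; have m0 := avg_gt0_mu b0.
have md : 0 < fine (mu (B (dil b))).
  by rewrite (lt_le_trans m0)// mu_le//; exact: (eng_sub eng).
apply: divr_gt0; last exact: sig_gt0.
by have := avgE m0; rewrite /Phi/= /induced_measure => ->; exact: mulr_gt0.
Qed.

(** [level_sum] is applied to the base 2 levels of [al]. On one level the balls are grouped under a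
    maximal family; each group is bounded by [carleson_packing] (4 kappa S), then by
    [dil_average_upper] (factor 2), and the family overlaps at most 4 kappa times, whence 32 kappa^2
    S. *)
Lemma carleson_embedding :
  (\sum_(b <- F) (al b `^ p)%:E * sig (B (dil b)) <=
   (32 * kappa ^+ 2 * S * level_const p)%:E * \int[sig]_x (g x `^ p)%:E)%E.
Proof.
have muE u D : measurable_fun D (fun x => (upper g u x)%:E).
  by apply/measurable_funTS/measurable_EFinP; exact: measurable_upper.
have upper0 u x : (0 <= (upper g u x)%:E)%E by rewrite lee_fin upper_ge0.
apply: level_sum => //.
  by rewrite !mulr_ge0 ?(ltW k0).
  exact: al_gt0.
move=> j; rewrite -big_filter; set Fj := [seq b <- F | _].
have [|b|M [uM MFj Mcov Mov]] := @exists_maximal_family Fj; first exact: filter_uniq.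
  by rewrite mem_filter => /andP[].
apply: (@le_trans _ _ (\sum_(r <- M) (4 * kappa * S)%:E * sig (B (dil r)))%E).
  apply: (@le_trans _ _ (\sum_(r <- M)
     \sum_(b <- F | `[< B (dil b) `<=` B (dil r) >]) sig (B (dil b)))%E); last first.
    by apply: lee_sum => r _; exact: carleson_packing.
  apply: (@le_trans _ _ (\sum_(r <- M)
     \sum_(b <- Fj | `[< B (dil b) `<=` B (dil r) >]) sig (B (dil b)))%E); last first.
    apply: lee_sum => r _; rewrite /Fj big_filter_cond big_mkcond [leRHS]big_mkcond.
    by apply: lee_sum => b _; case: ifP => [/andP[_ ->]//|_]; case: ifP.
  rewrite (exchange_big_dep xpredT)//= big_seq [leRHS]big_seq.
  apply: lee_sum => b /Mcov[r rM br].
  by rewrite (big_rem r)//= asboolT// leeDl// sume_ge0.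
apply: (@le_trans _ _ (\sum_(r <- M) (4 * kappa * S)%:E *
    ((2 / 2 `^ j%:~R)%:E * \int[sig]_(x in B r) (upper g (2 `^ (j - 1)%:~R) x)%:E))%E).
  rewrite big_seq [leRHS]big_seq; apply: lee_sum => r /MFj.
  rewrite mem_filter => /andP[/eqP rj rF].
  rewrite lee_wpmul2l ?lee_fin ?mulr_ge0 ?(ltW k0)//.
  have -> : 2 `^ (j - 1)%:~R = 2 `^ j%:~R / 2 :> R.
    by rewrite intrB (@powRB _ 2) ?pnatr_eq0 ?implybT// powRr1.
  apply: (dil_average_upper mB (eng_sub eng) sig_fin mg g0).
    by rewrite powR_gt0.
  by have /andP[] := levP (a := 2) (ltr1n R 2) (al_gt0 rF); rewrite rj.
under eq_bigr do rewrite muleA -EFinM.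
rewrite -ge0_sume_distrr; last by move=> b _; exact: integral_ge0.
have -> : 32 * kappa ^+ 2 * S / 2 `^ j%:~R =
  4 * kappa * S * (2 / 2 `^ j%:~R) * (4 * kappa) by ring.
rewrite (EFinM _ (4 * kappa)) -muleA lee_wpmul2l//.
  by rewrite lee_fin !mulr_ge0 ?invr_ge0 ?powR_ge0// ltW.
by apply: sum_integral_overlap.
Qed.

End sparse_family.

(** The factor a^p comes from the selection with base [a], kappa^p from [Ap_dil], the last from the
    Carleson embedding. *)
Definition sparse_const : R :=
  a `^ p * kappa `^ p * (32 * kappa ^+ 2 * level_const p).

(** Balls that are not good receive coefficient 0, so the selection keeps good balls only. *)
Lemma sparse_fmax (S : R) (s : seq nat) : 0 <= S ->
  (forall b n, (\int[mu]_(x in B b) (fmax B (iota 0 n)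
     (fun b' => fine (sig (B b' `&` B b)) / fine (mu (B b'))) x)%:E <=
     S%:E * sig (B b))%E) ->
  (\int[om]_x (fmax B s (fun b => if `[< good b >] then avg b else 0) x `^ p)%:E <=
   (W * S * sparse_const)%:E * \int[sig]_x (g x `^ p)%:E)%E.
Proof.
move=> S0 AinfS; set beta := fun b => if `[< good b >] then avg b else 0.
have [F [uF Fs F0 dF leF]] := fmax_powR_le (eng_vitali eng) s beta a1 p0.
have goodF b : b \in F -> good b.
  by move=> /F0; rewrite /beta; case: asboolP; rewrite ?ltxx.
have betaF b : b \in F -> beta b = avg b.
  by move=> /goodF gb; rewrite /beta asboolT.
have disjF b b' : b \in F -> b' \in F -> b != b' -> lv b = lv b' ->
    B b `&` B b' = set0.
  by move=> bF b'F bb' l; apply: dF => //; rewrite !betaF.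
apply: (@le_trans _ _ (\sum_(b <- F) (a `^ p * avg b `^ p)%:E * om (B (dil b)))%E).
  rewrite [leRHS](_ : _ = \sum_(b <- F) (a `^ p * beta b `^ p)%:E * om (B (dil b)))%E.
    apply: integral_le_sum_indic leF => //.
    - by apply: measurableT_comp (measurable_powR _) _; exact: measurable_fmax.
    - by move=> x; rewrite powR_ge0.
    - by move=> b; rewrite mulr_ge0 ?powR_ge0.
  by rewrite big_seq [RHS]big_seq; apply: eq_bigr => b /betaF ->.
(* With avg b = al sig(B (dil b)) / mu(B b), [Ap_dil] trades om(B (dil b)) sig(B (dil b))^(p-1) /
   mu(B b)^p for W kappa^p, leaving al^p sig(B (dil b)). *)
apply: (@le_trans _ _ (\sum_(b <- F) (a `^ p * (W * kappa `^ p))%:E *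
    ((dil_average B dil sig g b `^ p)%:E * sig (B (dil b))))%E).
  rewrite big_seq [leRHS]big_seq; apply: lee_sum => b /goodF[b0 _].
  have m0 := avg_gt0_mu b0.
  have md : 0 < fine (mu (B (dil b))).
    by rewrite (lt_le_trans m0)// mu_le//; exact: (eng_sub eng).
  have s0 := sig_gt0 md.
  rewrite -[om _]fineK ?ge0_fin_numE// -[sig _]fineK ?ge0_fin_numE// -!EFinM lee_fin.
  rewrite -!mulrA ler_wpM2l ?powR_ge0//.
  set al := dil_average _ _ _ _ b.
  have al0 : 0 <= al by exact: dil_average_ge0.
  have im0 : 0 <= (fine (mu (B b)))^-1 by rewrite invr_ge0 ltW.
  have -> : avg b = al * (fine (sig (B (dil b))) / fine (mu (B b))).
    by rewrite /avg /al /dil_average mulrA divfK// gt_eqF.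
  rewrite (powRM _ al0 (mulr_ge0 (ltW s0) im0)) (powRM _ (ltW s0) im0).
  have -> : (fine (mu (B b)))^-1 `^ p = (fine (mu (B b)) `^ p)^-1.
    by rewrite -powR_inv1 ?(ltW m0)// powRAC powR_inv1 ?powR_ge0.
  rewrite -(mulr_powRB1 (ltW s0) p0).
  have := Ap_dil b; rewrite -ler_pdivrMr ?powR_gt0// => H.
  rewrite [leRHS](_ : _ = al `^ p * fine (sig (B (dil b))) * (W * kappa `^ p)); last by ring.
  rewrite [leLHS](_ : _ = al `^ p * fine (sig (B (dil b))) *
    (fine (om (B (dil b))) * fine (sig (B (dil b))) `^ (p - 1) / fine (mu (B b)) `^ p)); last by ring.
  by rewrite ler_wpM2l// mulr_ge0 ?powR_ge0// ltW.
rewrite -ge0_sume_distrr; last by move=> b _; rewrite mule_ge0// lee_fin powR_ge0.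
apply: (@le_trans _ _ ((a `^ p * (W * kappa `^ p))%:E *
    ((32 * kappa ^+ 2 * S * level_const p)%:E * \int[sig]_x (g x `^ p)%:E))%E).
  rewrite lee_wpmul2l//; first by rewrite lee_fin !mulr_ge0 ?powR_ge0.
  exact: (carleson_embedding uF goodF disjF S0 AinfS).
rewrite muleA -EFinM le_eqVlt; apply/orP; left; apply/eqP; congr (_%:E * _)%E.
by rewrite /sparse_const; ring.
Qed.

Lemma buckley_const_ge0 : 0 <= buckley_const.
Proof.
have sq := ltW (strong_const_gt0 q1); have sp := ltW (strong_const_gt0 p1).
exact: mulr_ge0 (mulr_ge0 (powR_ge0 _ _) sq) sp.
Qed.

Lemma buckley_bound (c : R) (f : T -> \bar R) : 0 <= c ->
  (forall x, 0 <= f x <= c%:E * sup_fmax B avg x)%E ->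
  (\int[om]_x f x `^ p <=
   (c `^ p * (W `^ q * buckley_const))%:E * \int[sig]_x (g x `^ p)%:E)%E.
Proof.
move=> c0 fP.
have [H [mH H0 HK HP]] := integral_sup_fmax mB p0 (fun n => buckley_fmax (iota 0 n)).
rewrite EFinM -muleA; apply: (@le_trans _ _ ((c `^ p)%:E * \int[om]_x H x)%E); last first.
  by rewrite lee_wpmul2l ?lee_fin ?powR_ge0.
rewrite -ge0_integralZl ?lee_fin ?powR_ge0//; apply: integral_le_ae.
- by move=> x; exact: poweR_ge0.
- exact: measurable_funeM.
- by move=> x; rewrite mule_ge0 ?lee_fin ?powR_ge0.
apply/nearW => x; have /andP[fx0 fx] := fP x.
apply: (@le_trans _ _ ((c%:E * sup_fmax B avg x) `^ p)%E).
  have cs0 := le_trans fx0 fx.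
  by apply: gt0_ler_poweR (ltW p0) _ _ _ _ fx; rewrite in_itv/= leey andbT.
by rewrite poweRM ?sup_fmax_ge0// poweR_EFin lee_wpmul2l ?lee_fin ?powR_ge0.
Qed.

(** Let a^k < sup <= a^(k+1). Every ball through [x] with average above a^k has level exactly [k],
    and [x] itself witnesses that it is good; such balls suffice to reach the supremum. *)
Lemma sup_fmax_good x : (sup_fmax B avg x < +oo)%E ->
  (sup_fmax B avg x <= sup_fmax B (fun b => if `[< good b >] then avg b else 0%R) x)%E.
Proof.
move=> Mfin; have M0 : (0 <= sup_fmax B avg x)%E by exact: sup_fmax_ge0.
set M := fine (sup_fmax B avg x).
have ME : sup_fmax B avg x = M%:E by rewrite fineK// ge0_fin_numE.
have leM b : B b x -> avg b <= M by move=> Bx; rewrite -lee_fin -ME sup_fmax_ge.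
have [MN|M_gt0] := leP M 0.
  apply: sup_fmax_le; first exact: sup_fmax_ge0.
  move=> b /leM bM; apply: le_trans (sup_fmax_ge0 _ _ _).
  by rewrite lee_fin (le_trans bM).
have /andP[kM Mk] := levP a1 M_gt0; set k := lev a M in kM Mk.
have top b : B b x -> a `^ k%:~R < avg b -> good b.
  move=> Bx kb; split; first by rewrite (le_lt_trans _ kb)// powR_ge0.
  have -> : lv b = k by apply: lev_unique a1 _; rewrite kb (le_trans (leM _ Bx)).
  by exists x => // b' /leM/le_trans; apply.
have [b Bx kb] : exists2 b, B b x & a `^ k%:~R < avg b.
  apply: contrapT => nb; suff : (sup_fmax B avg x <= (a `^ k%:~R)%:E)%E.
    by rewrite ME lee_fin leNgt kM.
  apply: sup_fmax_le => [|b Bx]; first by rewrite lee_fin powR_ge0.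
  by rewrite lee_fin leNgt; apply/negP => kb; apply: nb; exists b.
apply: sup_fmax_le => [|b' B'x]; first exact: sup_fmax_ge0.
pose beta b := if `[< good b >] then avg b else 0.
have [kb'|kb'] := ltP (a `^ k%:~R) (avg b').
  have -> : avg b' = beta b' by rewrite /beta asboolT//; exact: top.
  exact: sup_fmax_ge.
apply: (@le_trans _ _ (beta b)%:E); last exact: sup_fmax_ge.
rewrite /beta asboolT; last exact: top.
by rewrite lee_fin (le_trans kb')// ltW.
Qed.

Lemma sparse_bound (S c : R) (f : T -> \bar R) : 0 <= S -> 0 <= c ->
  (forall b n, (\int[mu]_(x in B b) (fmax B (iota 0 n)
     (fun b' => fine (sig (B b' `&` B b)) / fine (mu (B b'))) x)%:E <=
     S%:E * sig (B b))%E) ->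
  (forall x, 0 <= f x <= c%:E * sup_fmax B avg x)%E ->
  (\int[om]_x f x `^ p <=
   (c `^ p * (W * S * sparse_const))%:E * \int[sig]_x (g x `^ p)%:E)%E.
Proof.
move=> S0 c0 AinfS fP.
have [H [mH H0 HK HP]] := integral_sup_fmax mB p0 (fun n => sparse_fmax (iota 0 n) S0 AinfS).
have [H' [mH' H'0 H'K H'P]] := integral_sup_fmax mB p0 (fun n => buckley_fmax (iota 0 n)).
(* The unmixed bound is used only qualitatively, for the finiteness almost everywhere that
   [sup_fmax_good] asks for. *)
have fin : {ae om, forall x, (sup_fmax B avg x < +oo)%E}.
  have : om.-integrable setT H'.
    apply/integrableP; split => //.
    under eq_integral do rewrite gee0_abs//.
    apply: le_lt_trans H'K _; apply: lte_mul_pinfty => //.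
    by rewrite lee_fin; apply: mulr_ge0 (powR_ge0 _ _) buckley_const_ge0.
  move=> /(integrable_ae measurableT); apply: filterS => x /(_ I) Hx.
  have Hy : (H' x < +oo)%E by rewrite -ge0_fin_numE.
  have pn0 : p != 0 by rewrite gt_eqF.
  exact: lty_poweRy pn0 (le_lt_trans (H'P x) Hy).
rewrite EFinM -muleA; apply: (@le_trans _ _ ((c `^ p)%:E * \int[om]_x H x)%E); last first.
  by rewrite lee_wpmul2l ?lee_fin ?powR_ge0.
rewrite -ge0_integralZl ?lee_fin ?powR_ge0//; apply: integral_le_ae.
- by move=> x; exact: poweR_ge0.
- exact: measurable_funeM.
- by move=> x; rewrite mule_ge0 ?lee_fin ?powR_ge0.
apply: filterS fin => x xfin; have /andP[fx0 fx] := fP x.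
apply: (@le_trans _ _ ((c%:E * sup_fmax B avg x) `^ p)%E).
  have cs0 := le_trans fx0 fx.
  by apply: gt0_ler_poweR (ltW p0) _ _ _ _ fx; rewrite in_itv/= leey andbT.
rewrite poweRM ?sup_fmax_ge0// poweR_EFin lee_wpmul2l ?lee_fin ?powR_ge0//.
apply: le_trans (HP x); apply: gt0_ler_poweR (ltW p0) _ _ _ _ (sup_fmax_good xfin);
  by rewrite in_itv/= leey sup_fmax_ge0.
Qed.

End weights_core.

(** * Balls of a covering family *)

Section covering_balls.
Context (R : realType) (G : topologicalZmodType).
Variable mu : {measure set (borelType G) -> \bar R}.
Variables (D : R) (theta : int -> int) (U : int -> set G).
Hypothesis hmu : LCA_measure mu.
Hypothesis hU : covering_family mu D theta U.
Hypothesis symU : forall i, [set - x | x in U i] = U i.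

Lemma translateE (x y : G) V : translate x V y <-> V (y - x).
Proof.
split=> [[z Vz <-]|Vyx]; first by rewrite addrC addKr.
by exists (y - x) => //; rewrite addrC subrK.
Qed.

Let U0 i : U i 0. Proof. exact: nbhs_singleton (cf_nbhs hU i). Qed.

Let UN i z : U i z -> U i (- z).
Proof. by move=> Uz; rewrite -symU; exists z. Qed.

Let UB i y z : U i y -> U i z -> U (theta i) (y - z).
Proof. by move=> Uy Uz; apply: (cf_sub hU); exists y => //; exists z. Qed.

Let UD i y z : U i y -> U i z -> U (theta i) (y + z).
Proof. by move=> Uy /UN Uz; rewrite -[z]opprK; exact: UB. Qed.

Let Ule i j z : i <= j -> U i z -> U j z.
Proof. by move=> ij; exact: (cf_increasing hU ij). Qed.

Let thle i : i <= theta i. Proof. exact: (cf_theta_ge hU). Qed.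

Let thmono i j : i <= j -> theta i <= theta j.
Proof. exact: (cf_theta_increasing hU). Qed.

(** In y - s' = (y - s) - (x - s) + (x - s') the difference costs one application of [theta], the
    sum another. *)
Lemma translate_engulf (s s' x : G) i i' : i <= i' ->
  translate s (U i) x -> translate s' (U i') x ->
  translate s (U i) `<=` translate s' (U (theta (theta i'))).
Proof.
move=> ii' /translateE xs /translateE xs' y /translateE ys; apply/translateE.
have -> : y - s' = (y - s) - (x - s) + (x - s').
  by rewrite opprB (addrA (y - s)) subrK addrA subrK.
apply: UD; last exact: Ule (thle _) xs'.
by apply: Ule (thmono ii') _; exact: UB.
Qed.

(** The difference of two points of U(theta^2 i) falls in U(theta^3 i), hence in U(i'), so even the
    dilates are nested. *)
Lemma translate_engulf_dil (s s' x : G) i i' : theta (theta (theta i)) <= i' ->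
  translate s (U i) x -> translate s' (U i') x ->
  translate s (U (theta (theta i))) `<=` translate s' (U (theta (theta i'))).
Proof.
move=> ii' /translateE xs /translateE xs' y /translateE ys; apply/translateE.
have -> : y - s' = (y - s) - (x - s) + (x - s').
  by rewrite opprB (addrA (y - s)) subrK addrA subrK.
apply: Ule (thle _) _; apply: UD => //; apply: Ule ii' _; apply: UB => //.
exact: Ule (le_trans (thle _) (thle _)) xs.
Qed.

Lemma translate_measurable x i : measurable (translate x (U i) : set (borelType G)).
Proof.
have -> : translate x (U i) = (fun y => y - x) @^-1` U i.
  by apply/seteqP; split=> y /translateE.
have cx : continuous (fun y : G => y - x).
  move=> y; apply: (@continuous_comp _ _ _ (fun y : G => (y, x)) (fun z => z.1 - z.2)).
    by apply: cvg_pair => //=; exact: cvg_cst.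
  exact: sub_continuous.
have mx : measurable_fun [set: borelType G] ((fun y => y - x) : borelType G -> borelType G).
  apply: (@measurability _ _ (borelType G) (borelType G) setT _ (@open G)) => // _ [V oV <-].
  rewrite setTI; apply: sub_sigma_algebra.
  by move/continuousP : cx; apply.
by rewrite -[X in measurable X]setTI; apply: mx => //; exact: (cf_measurable hU).
Qed.

Lemma translate_compact x i : exists K : set G, [/\ compact K,
  measurable (K : set (borelType G)) & translate x (U i) `<=` K].
Proof.
have cK : compact (closure (U i)) by rewrite -precompactE; exact: (cf_precompact hU).
have cK' : compact ((fun y => x + y) @` closure (U i)).
  apply: continuous_compact cK; apply: continuous_subspaceT => y.
  apply: (@continuous_comp _ _ _ (fun y : G => (x, y)) (fun z => z.1 + z.2)).
    by apply: cvg_pair => //=; exact: cvg_cst.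
  exact: add_continuous.
exists ((fun y => x + y) @` closure (U i)); split => //.
  rewrite -[X in measurable X]setCK; apply: measurableC.
  apply: sub_sigma_algebra; rewrite openC.
  exact: compact_closed (LCA_hausdorff hmu) cK'.
by move=> _ [y Uy <-]; exists y => //; exact: subset_closure.
Qed.

Lemma translate_fin x i : (mu (translate x (U i)) < +oo)%E.
Proof.
have [K [cK mK sK]] := translate_compact x i.
apply: le_lt_trans (LCA_compact_finite hmu cK).
by apply: le_measure => //; rewrite inE//; exact: translate_measurable.
Qed.

(** [G] is the union of the relatively compact [U j], each covered by finitely many translates of
    the interior of [U i]; the centres for all pairs of indices form a countable set. *)
Lemma exists_dense_seq : exists c : nat -> G,
  forall x i, exists n, translate x (U i) (c n).
Proof.
have cov (i j : int) : exists s : seq G, forall x, U j x ->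
    exists2 y, y \in s & translate x (U i) y.
  have cK : compact (closure (U j)) by rewrite -precompactE; exact: (cf_precompact hU).
  have : cover_compact (closure (U j)).
    pose pG : ptopologicalType :=
      HB.pack (TopologicalZmodule.sort G) (isPointed.Build G 0).
    by have := cK; rewrite (_ : compact = @cover_compact pG)//; exact: compact_cover.
  move=> /(_ G setT (fun y => (fun z => z - y) @^-1` (U i)^°)).
  case.
  - move=> y _; apply: open_comp; last exact: open_interior.
    move=> z _; apply: (@continuous_comp _ _ _ (fun z : G => (z, y)) (fun z => z.1 - z.2)).
      by apply: cvg_pair => //=; exact: cvg_cst.
    exact: sub_continuous.
  - move=> y _; exists y => //=; rewrite subrr; exact: (cf_nbhs hU).
  move=> K' _ Kcov; exists (finmap.enum_fset K') => x Ujx.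
  have [y /= yK] := Kcov _ (subset_closure Ujx).
  move=> /interior_subset Uxy; exists y => //.
  by apply/translateE; rewrite -opprB; exact: UN.
have [s sP] := choice (fun ij : int * int => cov ij.1 ij.2).
pose dec n : int * int * nat := odflt (0, 0, 0%N) (unpickle n).
exists (fun n => nth 0 (s (dec n).1) (dec n).2) => x i.
have [j _ Ujx] : (\bigcup_j U j) x by rewrite (cf_bigcup hU).
have [y ys xy] := sP (i, j) x Ujx.
exists (pickle (i, j, index y (s (i, j)))).
by rewrite /dec pickleK/= nth_index.
Qed.

Variable c : nat -> G.
Hypothesis denseC : forall x i, exists n, translate x (U i) (c n).

(** An index codes a centre in the dense sequence and a radius index; the latter is the rank, and
    dilation applies [theta] to it twice. *)
Let dec n : nat * int := odflt (0%N, 0) (unpickle n).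

Definition cball n : set (borelType G) := translate (c (dec n).1) (U (dec n).2).
Definition crank n : int := (dec n).2.
Definition cdil n : nat := pickle ((dec n).1, theta (theta (dec n).2)).

Let cballE k i : cball (pickle (k, i)) = translate (c k) (U i).
Proof. by rewrite /cball /dec pickleK. Qed.

Let D1 : 1 <= D. Proof. exact: (cf_doubling_ge1 hU). Qed.

Let D0 : 0 <= D. Proof. exact: le_trans D1. Qed.

Let doubling_iter k s i :
  (mu (translate s (U (iter k theta i))) <= (D ^+ k)%:E * mu (translate s (U i)))%E.
Proof.
elim: k => [|k IH]; first by rewrite expr0 mul1e.
apply: le_trans (cf_doubling hU _ _) _; rewrite exprS EFinM -muleA.
by rewrite lee_wpmul2l ?lee_fin.
Qed.

(** Take a centre in x + U_i and the radius index [theta i]: the new ball contains the given one and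
    lies in its dilate by two steps of [theta]. *)
Lemma cball_comparison x i y : translate x (U i) y -> exists n,
  [/\ cball n y, translate x (U i) `<=` cball n &
    (mu (cball n) <= (D ^+ 2)%:E * mu (translate x (U i)))%E].
Proof.
move=> xy; have [k /translateE xk] := denseC x i.
have sub : translate x (U i) `<=` translate (c k) (U (theta i)).
  move=> z /translateE zx; apply/translateE.
  have -> : z - c k = (z - x) - (c k - x) by rewrite opprB addrA subrK.
  exact: UB.
exists (pickle (k, theta i)); rewrite cballE; split => //; first exact: sub.
apply: le_trans (doubling_iter 2 x i).
apply: le_measure; rewrite ?inE; try exact: translate_measurable.
move=> z /translateE zk; apply/translateE.
have -> : z - x = (z - c k) + (c k - x) by rewrite addrA subrK.
by apply: UD => //; exact: Ule (thle _) xk.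
Qed.

(* 7 = 5 + 2: for ranks [i' <= theta^3 i], five steps engulf the comparable ball and
   two steps compare it back. *)
Lemma covering_engulfing : engulfing mu (D ^+ 7) cball crank cdil.
Proof.
have DX (m n : nat) : (m <= n)%N -> D ^+ m <= D ^+ n by move=> mn; rewrite ler_weXn2l.
split.
- by rewrite exprn_ege1.
- by move=> b; exact: translate_measurable.
- by move=> b; exact: translate_fin.
- move=> b y; rewrite /cdil cballE => /translateE Uy.
  by apply/translateE; exact: Ule (le_trans (thle _) (thle _)) Uy.
- move=> b; rewrite /cdil cballE.
  apply: le_trans (doubling_iter 2 _ _) _.
  by rewrite lee_wpmul2r// lee_fin DX.
- move=> b b' [x [bx b'x]] rb; rewrite /cdil cballE.
  exact: translate_engulf rb bx b'x.
- exists (fun b => pickle ((dec b).1, iter 5 theta (dec b).2)).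
  move=> b b' [x [bx b'x]] rb; rewrite /cdil !cballE.
  (* The strict inequality is tested separately, as [theta] may fix an index; if it fails, the ranks
     agree and the second alternative holds. *)
  have [/andP[lt le]|nlt] := boolP ((crank b < crank b') &&
      (theta (theta (theta (crank b))) <= crank b')).
    left; split => //.
    exact: translate_engulf_dil le bx b'x.
  right.
  have le3 : crank b' <= iter 3 theta (crank b).
    move: nlt; rewrite negb_and -leNgt -ltNge => /orP[bb'|/ltW//].
    exact: le_trans bb' (le_trans (thle _) (le_trans (thle _) (thle _))).
  split.
    apply: translate_engulf le3 b'x _.
    move: bx => /translateE bx; apply/translateE; apply: Ule bx.
    exact: le_trans (thle _) (le_trans (thle _) (thle _)).
  apply: le_trans (doubling_iter 5 _ _) _.
  rewrite (exprD D 5 2) (EFinM (D ^+ 5) (D ^+ 2)) -muleA lee_wpmul2l ?lee_fin ?exprn_ge0//.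
  apply: le_trans (doubling_iter 2 _ _).
  apply: le_measure; rewrite ?inE; try exact: translate_measurable.
  exact: translate_engulf rb bx b'x.
Qed.

End covering_balls.

(** * Weights on the group *)

(** Measurability is assumed of [h] alone. One inequality is domination almost everywhere; for the
    other, [N] is removed from the domain of [h], and the domain is enlarged again for [f]. *)
Lemma integral_eq_off_null d (T : measurableType d) (R : realType)
    (mu : {measure set T -> \bar R}) (A N : set T) (f h : T -> \bar R) :
  measurable A -> measurable N -> mu N = 0%E -> measurable_fun setT h ->
  (forall x, 0 <= f x)%E -> (forall x, 0 <= h x)%E ->
  (forall x, ~ N x -> f x = h x) ->
  (\int[mu]_(x in A) f x = \int[mu]_(x in A) h x)%E.
Proof.
move=> mA mN N0 mh f0 h0 fh; apply/eqP; rewrite eq_le; apply/andP; split.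
  rewrite [leLHS]integral_mkcond [leRHS]integral_mkcond; apply: integral_le_ae.
  - by move=> x; rewrite /patch; case: ifP.
  - by apply/(measurable_restrictT _ mA); exact: measurable_funTS.
  - by move=> x; rewrite /patch; case: ifP.
  - exists N; split => // x /= nle; apply: contrapT => /fh fhx; apply: nle.
    by rewrite /patch fhx.
rewrite (ge0_negligible_integral mN mA (measurable_funTS mh) (fun x _ => h0 x) N0).
rewrite (@eq_integral _ _ _ mu (A `\` N) f h); last first.
  by move=> x /[!inE] -[_ /fh] ->.
rewrite [leLHS]integral_mkcond [leRHS]integral_mkcond.
apply: integral_le_nonmeasurable.
  by move=> x; rewrite /patch; case: ifP.
move=> x _; rewrite /patch; case: ifPn => [/[!inE] -[Ax _]|_].
  by rewrite mem_set.
by case: ifP.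
Qed.

Section lca_weights.
Context (R : realType) (G : topologicalZmodType).
Variable mu : {measure set (borelType G) -> \bar R}.
Variables (D : R) (theta : int -> int) (U : int -> set G).
Hypothesis hmu : LCA_measure mu.
Hypothesis hU : covering_family mu D theta U.
Hypothesis symU : forall i, [set - x | x in U i] = U i.
Variable p : R.
Hypothesis p1 : 1 < p.
Variable w : weight mu.
Hypothesis hAp : Ap U p w.

Let om : {measure set (borelType G) -> \bar R} := weighted_measure w.
Let e := (p - 1)^-1.
Let sw := dual_weight p w.
Let p10 : 0 < p - 1. Proof. by rewrite subr_gt0. Qed.

Let p0 : 0 < p. Proof. exact: lt_trans p1. Qed.

Let e0 : 0 < e. Proof. by rewrite invr_gt0. Qed.

Lemma dual_weightE x : sw x = ((w x `^ e)^-1)%E.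
Proof.
rewrite /sw /dual_weight /poweRz.
have -> : 1 - fine (hoelder_conjugate p%:E) = - e.
  rewrite /hoelder_conjugate/= eqe gt_eqF// -EFinB inver gt_eqF//=.
  by rewrite /e; field; rewrite gt_eqF.
by rewrite oppr_lt0 e0 opprK.
Qed.

Let sw_ge0 x : (0 <= sw x)%E.
Proof. by rewrite dual_weightE inve_ge0 poweR_ge0. Qed.

Let w_ge0 x : (0 <= w x)%E. Proof. exact: weight_ge0. Qed.

Let mw A : measurable_fun A w.
Proof. exact: measurable_funTS (weight_measurable w). Qed.

Let base_measurable V : base_sets U V -> measurable (V : set (borelType G)).
Proof. by move=> [x [i ->]]; exact: translate_measurable hU x i. Qed.

Let base_fin V : base_sets U V -> (mu V < +oo)%E.
Proof. by move=> [x [i ->]]; exact: translate_fin hmu hU x i. Qed.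

Let base_om_fin V : base_sets U V -> (om V < +oo)%E.
Proof.
move=> [x [i ->]]; have [K [cK mK sK]] := translate_compact hmu hU x i.
apply: le_lt_trans (weight_locally_integrable w cK).
by apply: ge0_subset_integral => //; exact: (translate_measurable hU).
Qed.

Let Apc := Ap_const mu U p w.

Lemma base_Ap V : base_sets U V ->
  (average mu V w * average mu V sw `^ (p - 1) <= Apc)%E.
Proof. by move=> hV; apply: ereal_sup_ubound; exists V. Qed.

(** An infinite average of the dual weight makes the A_p product infinite unless the average of [w]
    vanishes. *)
Lemma dual_weight_pinfty V : base_sets U V -> (0 < mu V)%E ->
  (\int[mu]_(x in V) sw x = +oo)%E -> om V = 0%E.
Proof.
move=> hV mV swV.
have mVn : mu V != 0%E by rewrite gt_eqF.
have mVy : mu V != +oo%E by rewrite lt_eqF// base_fin.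
have iV : (0 < (mu V)^-1)%E by rewrite inve_gt0.
have := le_lt_trans (base_Ap hV) hAp.
rewrite {2}/average swV gt0_muley// poweRyr ?gt_eqF// => ltV.
have : (0 <= average mu V w)%E.
  by rewrite mule_ge0// ?(ltW iV)// integral_ge0.
rewrite le_eqVlt => /predU1P[/esym/eqP|a0].
  by rewrite mule_eq0 (gt_eqF iV)/= => /eqP.
by move: ltV; rewrite gt0_muley// ltxx.
Qed.

(** * Weights that do not vanish almost everywhere *)

Section nontrivial_weight.
Hypothesis om_neq0 : om setT != 0%E.

Let ball n : set (borelType G) := translate 0 (U n%:Z).

Let ball_base n : base_sets U (ball n). Proof. by exists 0, n%:Z. Qed.

Let ball_cover x : exists n, ball n x.
Proof.
have [i _ Uix] : (\bigcup_i U i) x by rewrite (cf_bigcup hU).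
exists `|i|%N; apply/translateE; rewrite subr0.
by apply: (cf_increasing hU) Uix; rewrite abszE ler_norm.
Qed.

Let ball_mono n m : (n <= m)%N -> ball n `<=` ball m.
Proof.
move=> nm x /translateE Ux; apply/translateE; apply: (cf_increasing hU) Ux.
by rewrite lez_nat.
Qed.

Let Z : set (borelType G) := [set x | fine (w x) = 0].

Let mZ : measurable Z.
Proof.
rewrite (_ : Z = (fine \o w) @^-1` [set 0])// -[X in measurable X]setTI.
apply: (measurableT_comp (fine_measurable measurableT) (weight_measurable w)) => //.
Qed.

Let ZE x : Z x -> w x = 0%E \/ w x = +oo%E.
Proof.
rewrite /Z/=; case: (w x) (w_ge0 x) => [r _ /= ->| _ _|//]; first by left.
by right.
Qed.

Let mweight_set1 r : measurable (w @^-1` [set r]).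
Proof.
rewrite -[X in measurable X]setTI.
by apply: (weight_measurable w) => //; exact: emeasurable_set1.
Qed.

Let infty_null n : mu ((w @^-1` [set +oo%E]) `&` ball n) = 0%E.
Proof.
have mb : measurable (ball n) by exact: base_measurable.
have /integrable_ae : mu.-integrable (ball n) w.
  apply/integrableP; split => //.
  by under eq_integral do rewrite gee0_abs//; exact: base_om_fin.
move=> /(_ mb) wfin; apply: measure_negligible; first exact: measurableI.
by apply: negligibleS wfin => x [/= wx bx] /(_ bx); rewrite wx.
Qed.

(** If [w] vanished on a set of positive measure in [ball n], the dual weight would have infinite
    integral over every larger ball, so [om] would vanish on all of them and hence on the whole
    group. *)
Let zero_null n : mu ((w @^-1` [set 0%E]) `&` ball n) = 0%E.
Proof.
have mb m : measurable (ball m) by exact: base_measurable.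
apply/eqP; apply: contraT => Zn; have mZn := measurableI _ _ (mweight_set1 0%E) (mb n).
have Zn0 : (0 < mu ((w @^-1` [set 0%E]) `&` ball n))%E.
  by rewrite lt0e Zn measure_ge0.
have om0 m : (n <= m)%N -> om (ball m) = 0%E.
  move=> nm; apply: dual_weight_pinfty => //.
    apply: lt_le_trans Zn0 _; apply: le_measure; rewrite ?inE//.
    by move=> x [_ /(ball_mono nm)].
  apply/eqP; rewrite -leye_eq.
  apply: (@le_trans _ _ (\int[mu]_(x in (w @^-1` [set 0%E]) `&` ball n) cst +oo x)%E).
    by rewrite integral_cst// gt0_mulye.
  rewrite [leLHS]integral_mkcond [leRHS]integral_mkcond.
  apply: integral_le_nonmeasurable.
    by move=> x; rewrite /patch; case: ifP => _ /=; rewrite ?leey.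
  move=> x _; rewrite /patch; case: ifPn => [/[!inE] -[/= wx bx]|_]; last by case: ifP.
  by rewrite mem_set ?dual_weightE ?wx ?poweR0r ?gt_eqF// ?inver ?eqxx//; exact: ball_mono nm _ bx.
case/negP : om_neq0; apply/eqP; apply: measure_negligible => //.
apply: (@negligibleS _ _ _ _ (\bigcup_m ball (n + m)%N)).
  move=> x _; have [m bx] := ball_cover x; exists m => //.
  by apply: ball_mono bx; exact: leq_addl.
apply: negligible_bigcup => m; apply/negligibleP => //.
by apply: om0; exact: leq_addr.
Qed.

Let Z_null : mu Z = 0%E.
Proof.
apply: measure_negligible => //.
apply: (@negligibleS _ _ _ _ (\bigcup_n (((w @^-1` [set 0%E]) `&` ball n) `|`
    ((w @^-1` [set +oo%E]) `&` ball n)))).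
  move=> x Zx; have [n bx] := ball_cover x; exists n => //.
  by case: (ZE Zx) => wx; [left|right].
have mb n : measurable (ball n) by exact: base_measurable.
apply: negligible_bigcup => n; apply: negligibleU.
- by apply/negligibleP; [exact: measurableI|exact: zero_null].
- by apply/negligibleP; [exact: measurableI|exact: infty_null].
Qed.

(* Modification of [w] on the null set where it is 0 or infinite ([fine +oo = 0]). *)
Definition real_weight (x : borelType G) : R := fine (w x) + \1_Z x.

Let v := real_weight.

Let mv : measurable_fun setT v.
Proof.
apply: measurable_funD; last exact: measurable_indic.
exact: (measurableT_comp (fine_measurable measurableT) (weight_measurable w)).
Qed.

Let v_gt0 x : 0 < v x.
Proof.
rewrite /v /real_weight indicE; have [/[!inE] Zx|] := boolP (x \in Z).
  by rewrite [fine _]Zx add0r.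
rewrite notin_setE => nZ; rewrite addr0 lt_neqAle fine_ge0// andbT eq_sym.
exact/eqP.
Qed.

Let vE x : ~ Z x -> w x = (v x)%:E.
Proof.
move=> nZ; rewrite /v /real_weight indicE memNset// addr0.
move: nZ; rewrite /Z/=; case: (w x) (w_ge0 x) => [r _ _ //|_ /= |//].
by move/(_ erefl).
Qed.

Let mvp c : measurable_fun setT (fun x => (v x `^ c)%:E).
Proof. by apply/measurable_EFinP; exact: measurableT_comp (measurable_powR _) mv. Qed.

Let vp0 c x : (0 <= (v x `^ c)%:E)%E. Proof. by rewrite lee_fin powR_ge0. Qed.

Let sig : {measure set (borelType G) -> \bar R} :=
  induced_measure mu (mvp (- e)) (vp0 (- e)).

Let omE A : measurable A -> om A = (\int[mu]_(x in A) (v x)%:E)%E.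
Proof.
move=> mA; apply: (integral_eq_off_null mA mZ Z_null) => //.
- exact/measurable_EFinP.
- by move=> x; rewrite lee_fin ltW.
Qed.

Let swE x : ~ Z x -> sw x = (v x `^ (- e))%:E.
Proof.
move=> nZ; rewrite dual_weightE vE// poweR_EFin inver gt_eqF ?powR_gt0//.
by rewrite powRN.
Qed.

Let sigE A : measurable A -> (\int[mu]_(x in A) sw x)%E = sig A.
Proof.
by move=> mA; apply: (integral_eq_off_null mA mZ Z_null) => //; exact: swE.
Qed.

Let om_eq0 V : base_sets U V -> om V = 0%E -> mu V = 0%E.
Proof.
by move=> /base_measurable mV; rewrite omE//; exact: density_eq0.
Qed.

(** An infinite value forces [om V] to be 0, so V is null because [v] is positive; but integrals
    over null sets are 0. *)
Let base_sig_fin V : base_sets U V -> (sig V < +oo)%E.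
Proof.
move=> hV; have mV := base_measurable hV; rewrite ltey; apply/negP => /eqP sV.
have [mV0|mV0] := eqVneq (mu V) 0%E.
  by move: sV; rewrite /sig/= /induced_measure null_set_integral//; exact: measurable_funTS.
case/eqP: (mV0); apply: om_eq0 => //; apply: dual_weight_pinfty => //.
  by rewrite lt0e mV0 measure_ge0.
by rewrite sigE.
Qed.

Let Apc_ge0 : (0 <= Apc)%E.
Proof.
apply: le_trans (base_Ap (ball_base 0)); rewrite mule_ge0 ?poweR_ge0//.
by rewrite mule_ge0 ?inve_ge0// integral_ge0.
Qed.

Let Apc_fin : Apc \is a fin_num. Proof. by rewrite ge0_fin_numE. Qed.

Let W := fine Apc.

Let om_null V : measurable V -> mu V = 0%E -> om V = 0%E.
Proof. by move=> mV V0; rewrite /om/= /weighted_measure null_set_integral. Qed.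

Let base_mu_fin V : base_sets U V -> mu V \is a fin_num.
Proof. by move=> hV; rewrite ge0_fin_numE// base_fin. Qed.

Let base_om_finn V : base_sets U V -> om V \is a fin_num.
Proof. by move=> hV; rewrite ge0_fin_numE// base_om_fin. Qed.

Let base_sig_finn V : base_sets U V -> sig V \is a fin_num.
Proof. by move=> hV; rewrite ge0_fin_numE// base_sig_fin. Qed.

Let inve_mu V : base_sets U V -> mu V != 0%E ->
  0 < fine (mu V) /\ ((mu V)^-1 = (fine (mu V))^-1%:E)%E.
Proof.
move=> hV V0; have Vf := base_mu_fin hV.
have m0 : 0 < fine (mu V) by rewrite fine_gt0// lt0e V0 measure_ge0/= base_fin.
by split => //; rewrite -[in LHS](fineK Vf) inver gt_eqF.
Qed.

Lemma real_Ap V : base_sets U V ->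
  fine (om V) * fine (sig V) `^ (p - 1) <= W * fine (mu V) `^ p.
Proof.
move=> hV; have mV := base_measurable hV.
have W0 : 0 <= W by rewrite fine_ge0.
have [V0|V0] := eqVneq (mu V) 0%E.
  by rewrite om_null// mul0r mulr_ge0 ?powR_ge0.
have [m0 mE] := inve_mu hV V0.
have := base_Ap hV; rewrite /average mE sigE//.
rewrite -[X in (_ * X * _)%E]/(om V) -(fineK (base_om_finn hV)).
rewrite -(fineK (base_sig_finn hV)) -!EFinM.
rewrite -(fineK Apc_fin) lee_fin -/W.
have im0 : 0 <= (fine (mu V))^-1 by rewrite invr_ge0 ltW.
rewrite powRM ?fine_ge0//.
have -> : (fine (mu V))^-1 `^ (p - 1) = (fine (mu V) `^ (p - 1))^-1.
  by rewrite -powR_inv1 ?(ltW m0)// powRAC powR_inv1 ?powR_ge0.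
rewrite -(mulr_powRB1 (ltW m0) p0) => h.
rewrite -ler_pdivrMr ?mulr_gt0 ?powR_gt0//; apply: le_trans h.
by rewrite invfM le_eqVlt; apply/orP; left; apply/eqP; ring.
Qed.

Let base_self x i : translate x (U i) x.
Proof. by apply/translateE; rewrite subrr; exact: nbhs_singleton (cf_nbhs hU i). Qed.

Let average_ge0 V (h : borelType G -> \bar R) : (0 <= average mu V (fun y => `|h y|))%E.
Proof. by rewrite mule_ge0 ?inve_ge0// integral_ge0. Qed.

Lemma maximal_ge0 h x : (0 <= maximal mu U h x)%E.
Proof.
apply: le_trans (average_ge0 (translate x (U 0)) h) _; apply: ereal_sup_ubound.
by exists (translate x (U 0)) => //; split; [exists x, 0|exact: base_self].
Qed.

(** * Reduction to the balls of a dense sequence *)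

Section dense_sequence.
Variable c : nat -> G.
Hypothesis denseC : forall x i, exists n, translate x (U i) (c n).
Let B := cball U c.

Let B_base n : base_sets U (B n).
Proof. by eexists; eexists; reflexivity. Qed.

Lemma Ainfty_fmax (S : R) V n : Ainfty_const mu U sw = S%:E -> base_sets U V ->
  (\int[mu]_(x in V) (fmax B (iota 0 n)
     (fun b' => fine (sig (B b' `&` V)) / fine (mu (B b'))) x)%:E <= S%:E * sig V)%E.
Proof.
move=> SE hV; have mV := base_measurable hV.
apply: (@le_trans _ _ (\int[mu]_(x in V) maximal mu U (sw \_ V) x)%E).
  apply: integral_le_nonmeasurable => [x|x Vx]; first by rewrite lee_fin fmax_ge0.
  set beta := fun b' => _ / _.
  have [x0|x0] := ltP 0 (fmax B (iota 0 n) beta x); last first.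
    by apply: le_trans (maximal_ge0 _ _); rewrite lee_fin.
  have [b [_ Bx bE]] := fmax_attained x0.
  apply: (@le_trans _ _ (average mu (B b) (fun y => `|(sw \_ V) y|)%E)); last first.
    by apply: ereal_sup_ubound; exists (B b).
  have mb := base_measurable (B_base b).
  have [b0|b0] := eqVneq (mu (B b)) 0%E.
    by move: x0; rewrite bE /beta b0 invr0 mulr0 ltxx.
  have [m0 mE] := inve_mu (B_base b) b0.
  rewrite /average mE bE /beta.
  have -> : (\int[mu]_(y in B b) `|(sw \_ V) y| = sig (B b `&` V))%E.
    rewrite -sigE; last exact: measurableI.
    rewrite integral_mkcondr; apply: eq_integral => y _.
    by rewrite gee0_abs// /patch; case: ifP.
  have fI : sig (B b `&` V) \is a fin_num.
    rewrite ge0_fin_numE// (le_lt_trans _ (base_sig_fin hV))//.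
    by apply: le_measure; rewrite ?inE//; exact: measurableI.
  by rewrite -(fineK fI) -EFinM mulrC.
have : ((sig V)^-1 * \int[mu]_(x in V) maximal mu U (sw \_ V) x <= S%:E)%E.
  by rewrite -SE -sigE//; apply: ereal_sup_ubound; exists V.
set I := (\int[mu]_(x in V) _)%E; have I0 : (0 <= I)%E.
  by apply: integral_ge0 => x _; exact: maximal_ge0.
(* The inverse of 0 is +oo, so a finite constant forces the integral to be 0. *)
have [s0|s0] := eqVneq (sig V) 0%E.
  rewrite s0 inver eqxx mule0; move: I0; rewrite le_eqVlt => /predU1P[<-//|I0].
  by rewrite gt0_mulye// leye_eq.
have sf := base_sig_finn hV.
have s_gt0 : 0 < fine (sig V) by rewrite fine_gt0// lt0e s0 measure_ge0/= ltey_eq sf.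
rewrite -(fineK sf) inver gt_eqF// => h.
by rewrite -lee_pdivrMr// muleC.
Qed.

Variable f : borelType G -> R.
Hypothesis mf : measurable_fun setT f.

(** Chosen so that |f| = g sigma; then g^p sigma = |f|^p v, because e p - e = 1. *)
Let g x := `|f x| * v x `^ e.

Let g0 x : 0 <= g x. Proof. by rewrite mulr_ge0// powR_ge0. Qed.

Let mg : measurable_fun setT g.
Proof.
apply: measurable_funM; first exact: measurableT_comp (@normr_measurable _ _) mf.
exact: measurableT_comp (measurable_powR _) mv.
Qed.

Let sig_density A : measurable A ->
  sig A = (\int[mu]_(x in A) (v x `^ (- e))%:E)%E.
Proof. by []. Qed.

Let vg0 x : (0 <= (g x)%:E)%E. Proof. by rewrite lee_fin. Qed.

Let powR_EFin_ge0 (y r : R) : (0 <= (y `^ r)%:E)%E.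
Proof. by rewrite lee_fin powR_ge0. Qed.

Let mvR r : measurable_fun setT (fun x => v x `^ r).
Proof. exact: measurableT_comp (measurable_powR _) mv. Qed.

Let mgE A : measurable_fun A (fun x => (g x)%:E).
Proof. exact/measurable_funTS/measurable_EFinP. Qed.

Let mgp : measurable_fun setT (fun x => (g x `^ p)%:E).
Proof. by apply/measurable_EFinP; exact: measurableT_comp (measurable_powR _) mg. Qed.

Let mfp : measurable_fun setT (fun x => (`|f x| `^ p)%:E).
Proof.
apply/measurable_EFinP; apply: measurableT_comp (measurable_powR _) _.
exact: measurableT_comp (@normr_measurable _ _) mf.
Qed.

Lemma integral_dual A : measurable A ->
  (\int[sig]_(x in A) (g x)%:E = \int[mu]_(x in A) `|(f x)%:E|)%E.
Proof.
move=> mA; rewrite (integral_density (mvR (- e)) (fun x => powR_ge0 _ _)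
  sig_density mA (fun x _ => vg0 x) (@mgE A)).
apply: eq_integral => x _; rewrite -EFinM /g -mulrA -powRD ?(gt_eqF (v_gt0 x)) ?implybT//.
by rewrite subrr powRr0 mulr1.
Qed.

Lemma integral_dual_powR :
  (\int[sig]_x (g x `^ p)%:E = \int[om]_x (`|f x| `^ p)%:E)%E.
Proof.
rewrite (integral_density (mvR (- e)) (fun x => powR_ge0 _ _)
  sig_density measurableT (fun x _ => powR_EFin_ge0 _ _) mgp).
rewrite (integral_density mv (fun x => ltW (v_gt0 x)) omE measurableT
  (fun x _ => powR_EFin_ge0 _ _) mfp).
apply: eq_integral => x _; rewrite -!EFinM /g powRM ?powR_ge0//.
rewrite -mulrA -powRrM -powRD ?(gt_eqF (v_gt0 x)) ?implybT//.
rewrite (_ : e * p - e = 1) ?powRr1 ?(ltW (v_gt0 x))//.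
by rewrite /e; field; rewrite gt_eqF.
Qed.

Hypothesis fp : (\int[om]_x (`|f x| `^ p)%:E < +oo)%E.

(** [cball_comparison] replaces every base set through [y] by a ball of the sequence at the cost of
    D^2, so the uncountable supremum is dominated by a countable one. *)
Lemma maximal_le_sup_fmax y :
  (0 <= maximal mu U (EFin \o f) y <=
   (D ^+ 2)%:E * sup_fmax B (avg mu sig B g) y)%E.
Proof.
rewrite maximal_ge0/=; apply: ge_ereal_sup => _ [V [hV Vy] <-].
have [x [i VE]] := hV; rewrite VE in hV Vy *.
have [n [Bny sub le]] := cball_comparison hU symU denseC Vy.
have mV := base_measurable hV; have mB := base_measurable (B_base n).
have D0 : 0 <= D ^+ 2 by rewrite exprn_ge0// (le_trans ler01)// (cf_doubling_ge1 hU).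
have s0 : (0 <= (D ^+ 2)%:E * sup_fmax B (avg mu sig B g) y)%E.
  by rewrite mule_ge0 ?sup_fmax_ge0.
have mfE A : measurable_fun A (fun x => `|(f x)%:E|)%E.
  apply/measurable_funTS/measurable_EFinP.
  exact: measurableT_comp (@normr_measurable _ _) mf.
(* The average over a null set is +oo * 0 = 0. *)
have [V0|V0] := eqVneq (mu (translate x (U i))) 0%E.
  by rewrite /average null_set_integral// mule0.
have [m0 mE] := inve_mu hV V0.
apply: (@le_trans _ _ ((D ^+ 2)%:E * (avg mu sig B g n)%:E)%E); last first.
  by rewrite lee_wpmul2l ?lee_fin// sup_fmax_ge.
have Bf := base_mu_fin (B_base n).
have leR : fine (mu (B n)) <= D ^+ 2 * fine (mu (translate x (U i))).
  by rewrite -lee_fin EFinM !fineK// base_mu_fin.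
have mB0 : 0 < fine (mu (B n)).
  by apply: lt_le_trans m0 _; rewrite fine_le// ?base_mu_fin//; apply: le_measure; rewrite ?inE.
have gp : (\int[sig]_x (g x `^ p)%:E < +oo)%E by rewrite integral_dual_powR.
have Phi_fin : (\int[mu]_(x in B n) `|(f x)%:E|)%E \is a fin_num.
  rewrite -integral_dual//; apply: (integral_ball_fin
    (covering_engulfing hmu hU symU c) p1 _ mg g0 gp).
  by move=> b; exact: base_sig_fin (B_base b).
have iDm : (fine (mu (translate x (U i))))^-1 <= D ^+ 2 / fine (mu (B n)).
  by rewrite ler_pdivlMr// mulrC ler_pdivrMr.
rewrite /average mE /avg integral_dual// -EFinM mulrCA mulrC EFinM fineK//.
apply: (@le_trans _ _ ((fine (mu (translate x (U i))))^-1%:E *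
    \int[mu]_(x in B n) `|(f x)%:E|)%E).
  rewrite lee_wpmul2l ?lee_fin ?invr_ge0 ?(ltW m0)//.
  exact: ge0_subset_integral.
by rewrite lee_wpmul2r ?lee_fin// integral_ge0.
Qed.

Let engB := covering_engulfing hmu hU symU c.

Let omB_fin b : (om (B b) < +oo)%E. Proof. exact: base_om_fin (B_base b). Qed.

Let sigB_fin b : (sig (B b) < +oo)%E. Proof. exact: base_sig_fin (B_base b). Qed.

Let W0 : 0 <= W. Proof. by rewrite fine_ge0. Qed.

Let ApB b : fine (om (B b)) * fine (sig (B b)) `^ (p - 1) <= W * fine (mu (B b)) `^ p.
Proof. exact: real_Ap (B_base b). Qed.

Let D20 : 0 <= D ^+ 2.
Proof. by rewrite exprn_ge0// (le_trans ler01)// (cf_doubling_ge1 hU). Qed.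

Lemma maximal_powR_buckley :
  (\int[om]_x maximal mu U (EFin \o f) x `^ p <=
   ((D ^+ 2) `^ p * (W `^ (p / (p - 1)) * buckley_const (D ^+ 7) p))%:E *
   \int[om]_x (`|f x| `^ p)%:E)%E.
Proof.
rewrite -integral_dual_powR.
exact: (buckley_bound engB p1 mv v_gt0 omE sig_density omB_fin sigB_fin W0 ApB
  mg g0 D20 maximal_le_sup_fmax).
Qed.

Lemma maximal_powR_sparse (S : R) : Ainfty_const mu U sw = S%:E -> 0 <= S ->
  (\int[om]_x maximal mu U (EFin \o f) x `^ p <=
   ((D ^+ 2) `^ p * (W * S * sparse_const (D ^+ 7) p))%:E *
   \int[om]_x (`|f x| `^ p)%:E)%E.
Proof.
move=> SE S0; have gp : (\int[sig]_x (g x `^ p)%:E < +oo)%E by rewrite integral_dual_powR.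
rewrite -integral_dual_powR.
apply: (sparse_bound engB p1 mv v_gt0 omE sig_density omB_fin sigB_fin W0 ApB
  mg g0 gp S0 D20 _ maximal_le_sup_fmax).
by move=> b n; exact: Ainfty_fmax SE (B_base b).
Qed.

End dense_sequence.

Lemma Lnorm_le_of_powR (F : borelType G -> \bar R) (f : borelType G -> R) (K : R) :
  (forall x, 0 <= F x)%E -> 0 <= K ->
  (\int[om]_x F x `^ p <= K%:E * \int[om]_x (`|f x| `^ p)%:E)%E ->
  ('N[om]_p%:E[F] <= (K `^ p^-1)%:E * 'N[om]_p%:E[EFin \o f])%E.
Proof.
move=> F0 K0 FK; rewrite unlock.
under eq_integral do rewrite gee0_abs//.
have I0 : (0 <= \int[om]_x (`|f x| `^ p)%:E)%E.
  by apply: integral_ge0 => x _; rewrite lee_fin powR_ge0.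
rewrite -poweR_EFin -poweRM ?lee_fin//.
apply: gt0_ler_poweR => //; rewrite ?invr_ge0 ?(ltW p0)// in_itv/= leey andbT.
  by apply: integral_ge0 => x _; exact: poweR_ge0.
by apply: mule_ge0; [rewrite lee_fin|exact: I0].
Qed.

(** D^2 is the cost of passing to countably many balls, and D^7 the engulfing constant of these
    balls. *)
Definition buckley_norm_const : R := D ^+ 2 * buckley_const (D ^+ 7) p `^ p^-1.
Definition mixed_norm_const : R := D ^+ 2 * sparse_const (D ^+ 7) p `^ p^-1.

Let W_ge0 : 0 <= W. Proof. by rewrite fine_ge0. Qed.

Let Dsq : 0 <= D ^+ 2. Proof. by rewrite exprn_even_ge0. Qed.

Let Lfun_fin (f : borelType G -> R) : f \in Lfun om p%:E ->
  measurable_fun setT f /\ (\int[om]_x (`|f x| `^ p)%:E < +oo)%E.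
Proof.
move=> /andP[/[!inE]/= mf]; rewrite /finite_norm unlock => fin; split => //.
by apply: lty_poweRy fin; rewrite invr_neq0// gt_eqF.
Qed.

Lemma maximal_buckley (f : borelType G -> R) : f \in Lfun om p%:E ->
  ('N[om]_p%:E[maximal mu U (EFin \o f)] <=
   buckley_norm_const%:E * Apc `^ e * 'N[om]_p%:E[EFin \o f])%E.
Proof.
move=> /Lfun_fin[mf fp]; have [c cP] := exists_dense_seq hU symU.
have bc0 : 0 <= buckley_const (D ^+ 7) p by exact: buckley_const_ge0.
apply: le_trans (Lnorm_le_of_powR _ _ (maximal_powR_buckley cP mf fp)) _.
- by move=> x; exact: maximal_ge0.
- exact: mulr_ge0 (powR_ge0 _ _) (mulr_ge0 (powR_ge0 _ _) bc0).
rewrite le_eqVlt; apply/orP; left; apply/eqP; congr (_ * _)%E.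
have -> : (Apc `^ e = (W `^ e)%:E)%E by rewrite -poweR_EFin fineK.
rewrite -EFinM; congr EFin.
rewrite (powRM _ (powR_ge0 _ _) (mulr_ge0 (powR_ge0 _ _) bc0)) (powRM _ (powR_ge0 _ _) bc0).
rewrite -!powRrM mulfV ?gt_eqF// powRr1// /buckley_norm_const.
have -> : p / (p - 1) / p = e by rewrite /e mulrAC mulfV ?mul1r// gt_eqF.
by rewrite [RHS]mulrAC mulrA.
Qed.

(** Serves the case of an infinite A_infinity constant: the product of the two constants must then
    be +oo, not +oo * 0 = 0. *)
Let Apc_gt0 : (0 < Apc)%E.
Proof.
have [n bn] : exists n, om (ball n) != 0%E.
  apply: contrapT => nb; case/negP: om_neq0; apply/eqP.
  apply: measure_negligible => //; apply: (@negligibleS _ _ _ _ (\bigcup_n ball n)).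
    by move=> x _; have [n bx] := ball_cover x; exists n.
  apply: negligible_bigcup => n; apply/negligibleP; first exact: base_measurable.
  by apply/eqP; apply: contrapT => /negP bn; apply: nb; exists n.
have mb : measurable (ball n) by exact: base_measurable.
have bb := ball_base n.
have mb0 : mu (ball n) != 0%E by apply: contraNneq bn => /om_null ->.
have sb0 : sig (ball n) != 0%E.
  apply: contraNneq mb0 => sb; apply/eqP; apply: density_eq0 sb => //.
  - exact: measurableT_comp (measurable_powR _) mv.
  - by move=> x; rewrite powR_gt0.
have om_gt0 : 0 < fine (om (ball n)).
  by rewrite fine_gt0// lt0e bn measure_ge0/= base_om_fin.
have sig_gt0 : 0 < fine (sig (ball n)).
  by rewrite fine_gt0// lt0e sb0 measure_ge0/= base_sig_fin.
have W_gt0 : 0 < W.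
  rewrite lt_neqAle W_ge0 andbT eq_sym; apply/eqP => W0.
  have := real_Ap bb; rewrite W0 mul0r leNgt.
  by rewrite mulr_gt0 ?powR_gt0.
by rewrite -(fineK Apc_fin) lte_fin.
Qed.

Let Ainfc := Ainfty_const mu U sw.

Let Ainfc_ge0 : (0 <= Ainfc)%E.
Proof.
apply: (@le_trans _ _ ((\int[mu]_(x in ball 0) sw x)^-1 *
   \int[mu]_(x in ball 0) maximal mu U (sw \_ (ball 0%N)) x)%E); last first.
  by apply: ereal_sup_ubound; exists (ball 0).
by rewrite mule_ge0 ?inve_ge0 ?integral_ge0// => x _; exact: maximal_ge0.
Qed.

Lemma maximal_mixed (f : borelType G -> R) : f \in Lfun om p%:E ->
  ('N[om]_p%:E[maximal mu U (EFin \o f)] <=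
   (mixed_norm_const + 1)%:E * (Apc * Ainfc) `^ p^-1 * 'N[om]_p%:E[EFin \o f])%E.
Proof.
move=> fL; have [mf fp] := Lfun_fin fL; have [c cP] := exists_dense_seq hU symU.
have mc0 : 0 <= mixed_norm_const by rewrite mulr_ge0 ?powR_ge0.
(* With an infinite A_infinity constant the right-hand side is +oo, unless the norm of [f] is 0,
   where [maximal_buckley] applies. The summand 1 keeps the constant positive for this case. *)
have [AE|Afin] := eqVneq Ainfc +oo%E.
  have [N0|N0] := eqVneq ('N[om]_p%:E[EFin \o f])%E 0%E.
    by have := maximal_buckley fL; rewrite N0 !mule0.
  rewrite AE gt0_muley// poweRyr ?invr_neq0 ?gt_eqF// gt0_muley ?lte_fin; last first.
    by rewrite (lt_le_trans ltr01)// lerDr.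
  by rewrite gt0_mulye ?leey// lt0e N0 Lnorm_ge0.
have Af : Ainfc \is a fin_num by rewrite ge0_fin_numE// ltey.
have S0 : 0 <= fine Ainfc by rewrite fine_ge0.
have sc0 : 0 <= sparse_const (D ^+ 7) p.
  apply: mulr_ge0; first exact: mulr_ge0 (powR_ge0 _ _) (powR_ge0 _ _).
  apply: mulr_ge0; last exact: ltW (level_const_gt0 p1).
  by rewrite mulr_ge0// exprn_even_ge0.
apply: le_trans (Lnorm_le_of_powR _ _ (maximal_powR_sparse cP mf fp (esym (fineK Af)) S0)) _.
- by move=> x; exact: maximal_ge0.
- exact: mulr_ge0 (powR_ge0 _ _) (mulr_ge0 (mulr_ge0 W_ge0 S0) sc0).
rewrite lee_wpmul2r ?Lnorm_ge0//.
have -> : (Apc * Ainfc = (W * fine Ainfc)%:E)%E by rewrite EFinM !fineK.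
rewrite poweR_EFin -EFinM lee_fin.
have WS0 := mulr_ge0 W_ge0 S0.
rewrite (powRM _ (powR_ge0 _ _) (mulr_ge0 WS0 sc0)) (powRM _ WS0 sc0).
rewrite -!powRrM mulfV ?gt_eqF// powRr1// mulrDl mul1r.
rewrite [X in _ <= X + _](_ : _ = D ^+ 2 * ((W * fine Ainfc) `^ p^-1 *
  sparse_const (D ^+ 7) p `^ p^-1)); last by rewrite /mixed_norm_const; ring.
by rewrite lerDl powR_ge0.
Qed.

End nontrivial_weight.

(** The whole space is null for [om], so the integrand is dominated by 0 almost everywhere,
    measurable or not. *)
Lemma Lnorm_trivial_weight (F : borelType G -> \bar R) : om setT = 0%E ->
  ('N[om]_p%:E[F] = 0)%E.
Proof.
move=> om0; rewrite unlock.
have -> : (\int[om]_x `|F x| `^ p = 0)%E; last by rewrite poweR0r// invr_neq0// gt_eqF.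
apply/eqP; rewrite eq_le; apply/andP; split; last first.
  by apply: integral_ge0 => x _; exact: poweR_ge0.
rewrite -(integral0 om setT); apply: integral_le_ae => //.
- by move=> x; exact: poweR_ge0.
- by exists setT; split.
Qed.

Lemma maximal_bounds :
  (forall f : borelType G -> R, f \in Lfun om p%:E ->
    ('N[om]_p%:E[maximal mu U (EFin \o f)] <=
     (buckley_norm_const + mixed_norm_const + 1)%:E *
     (Apc * Ainfty_const mu U sw) `^ p^-1 * 'N[om]_p%:E[EFin \o f])%E) /\
  (maximal_norm U p w <= (buckley_norm_const + mixed_norm_const + 1)%:E * Apc `^ e)%E.
Proof.
have bc0 : 0 <= buckley_norm_const by rewrite mulr_ge0 ?powR_ge0// exprn_even_ge0.
have mc0 : 0 <= mixed_norm_const by rewrite mulr_ge0 ?powR_ge0// exprn_even_ge0.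
have C0 : 0 <= buckley_norm_const + mixed_norm_const + 1 by rewrite !addr_ge0.
(* A weight vanishing almost everywhere is treated apart: all norms are 0. *)
have [om0|om0] := eqVneq (om setT) 0%E.
  split=> [f _|].
    rewrite (Lnorm_trivial_weight _ om0) mule_ge0 ?Lnorm_ge0// mule_ge0 ?poweR_ge0//.
  apply: ge_ereal_sup => _ [f _ <-].
  by rewrite (Lnorm_trivial_weight _ om0) mule_ge0 ?poweR_ge0.
split=> [f fL|].
  apply: le_trans (maximal_mixed om0 fL) _.
  rewrite lee_wpmul2r ?Lnorm_ge0// lee_wpmul2r ?poweR_ge0// lee_fin.
  by rewrite -addrA lerDr.
apply: ge_ereal_sup => _ [f [fL f1] <-].
apply: le_trans (maximal_buckley om0 fL) _.
rewrite -[leRHS]mule1; apply: lee_pmul => //; rewrite ?Lnorm_ge0//.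
  by rewrite mule_ge0 ?poweR_ge0.
rewrite lee_wpmul2r ?poweR_ge0// lee_fin.
by rewrite -addrA lerDl addr_ge0.
Qed.

End lca_weights.

Theorem theorem1p3 (R : realType) (p D : R) (p_gt1 : 1 < p) :
  exists C : R, 0 < C /\
  forall (G : topologicalZmodType)
    (mu : {measure set (borelType G) -> \bar R})
    (U : int -> set G) (theta : int -> int),
    LCA_measure mu ->
    covering_family mu D theta U ->
    (forall i, [set - x | x in U i] = U i) ->
    forall w : weight mu, Ap U p w ->
    (forall f : borelType G -> R, f \in Lfun (weighted_measure w) p%:E ->
       ('N[weighted_measure w]_p%:E[maximal mu U (EFin \o f)] <=
        C%:E * poweR (Ap_const mu U p w * Ainfty_const mu U (dual_weight p w))
                     p^-1
        * 'N[weighted_measure w]_p%:E[EFin \o f])%E) /\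
    (maximal_norm U p w <= C%:E * poweR (Ap_const mu U p w) (p - 1)^-1)%E.
Proof.
(* Positivity must hold for every real [D], as D >= 1 is known only once a covering family is given;
   it follows from D^2 >= 0 and the summand 1. *)
exists (buckley_norm_const D p + mixed_norm_const D p + 1); split.
  by rewrite ltr_pwDr// addr_ge0// mulr_ge0 ?powR_ge0// exprn_even_ge0.
by move=> G mu U theta hmu hU symU w hAp; exact: (maximal_bounds hmu hU symU p_gt1 hAp).
Qed.
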